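(* Fix integers $m\ge 2$ and $\ell\ge 2$. Let $W_n$ be the number of $\ell$-cycles in the uniform attachment graph $G^m_n$, and let $\mu_n:=\mathbb{E} W_n$. Then, as $n\to\infty$, $$\mu_n=\Theta(\log n),$$ and there is a positive constant $C=C(m,\ell)$ such that, for all sufficiently large $n$, $$d_{\mathrm{TV}}\bigl(\mathcal{L}(W_n),\mathrm{Po}(\mu_n)\bigr)\le C\,(\log n)^{-1}.$$
   Context: Uniform attachment graph: for integers $m,n\ge1$, $G^m_n$ is the random loopless multigraph on vertex set $[n]=\{1,\dots,n\}$ in which, for every $j\in\{2,\dots,n\}$ and every label $a\in[m]$, there is exactly one edge $j^{(a)}$ with label $a$ from $j$ to a vertex chosen uniformly at random in $[j-1]$, all choices being independent. Parallel edges are allowed and are distinguished by their labels (equivalently, $G^m_n$ is a random subgraph of the multigraph $K^m_n$ on $[n]$ having, for every $1\le i<j\le n$, $m$ edges $ji^{(1)},\dots,ji^{(m)}$ between $j$ and $i$). Subgraphs are regarded as undirected, and two subgraphs are different if their edge sets differ (also if they differ only in edge labels). An $\ell$-cycle is a cycle with $\ell$ edges and $\ell$ vertices; a pair of parallel edges is a 2-cycle. The number of $\ell$-cycles in $G^m_n$ is the number of (not necessarily induced) subgraphs of $G^m_n$ that are $\ell$-cycles. $\mathcal{L}(X)$ is the law of $X$; $\mathrm{Po}(\mu)$ is the Poisson distribution with mean $\mu$; $d_{\mathrm{TV}}(\nu_1,\nu_2)=\sup_A|\nu_1(A)-\nu_2(A)|$, supremum over sets $A$ of nonnegative integers. $a_n=\Theta(b_n)$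 means that there are constants $0<c\le C'<\infty$ not depending on $n$ with $cb_n\le a_n\le C'b_n$ for all sufficiently large $n$. *)

(* Defs.v *)
From HB Require Import structures.
From mathcomp Require Import all_boot all_order all_algebra.
From mathcomp Require Import finmap.
From mathcomp Require Import all_classical all_reals all_analysis.

Set Implicit Arguments.
Unset Strict Implicit.
Unset Printing Implicit Defensive.

Import Order.TTheory GRing.Theory Num.Theory.

Local Open Scope classical_set_scope.
Local Open Scope ring_scope.

(* The vertices 1, ..., n are represented by 'I_n, so that v : 'I_n stands for *)
(* the vertex v + 1 and has exactly v predecessors, namely 'I_v. A half-edge   *)
(* (j, a) is a vertex j other than the first one, with a label a.              *)
Definition half_edge (m n : nat) : finType :=
  ({j : 'I_n | (0 < j)%N} * 'I_m)%type.

(* The edges ji^(a), i < j, of the multigraph K^m_n: Tagged _ i, with i : 'I_j *)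
(* and tag (j, a).                                                             *)
Definition edge (m n : nat) : finType :=
  {p : half_edge m n & 'I_(val p.1)}.

Definition older_end (m n : nat) (e : edge m n) : 'I_n :=
  widen_ord (ltnW (ltn_ord (val (tag e).1))) (tagged e).

Definition newer_end (m n : nat) (e : edge m n) : 'I_n := val (tag e).1.

Definition joins (m n : nat) (e : edge m n) (u v : 'I_n) : bool :=
  ((older_end e, newer_end e) == (u, v))
  || ((older_end e, newer_end e) == (v, u)).

(* Cycles are identified with their edge sets: S is an l-cycle if its edges    *)
(* can be listed without repetition as e_0, ..., e_(l-1), with e_i joining v_i *)
(* to v_(i+1 mod l), for distinct vertices v_0, ..., v_(l-1). Requiring the    *)
(* e_i to be distinct matters for l = 2 only.                                  *)
Definition is_cycle (m n l : nat) (S : {set edge m n}) : bool :=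
  [exists v : {ffun 'I_l -> 'I_n}, exists e : {ffun 'I_l -> edge m n},
    [&& injectiveb v, injectiveb e,
        [forall i : 'I_l, joins (e i) (v i) (v (ordS i))]
      & S == [set e i | i : 'I_l]%SET]].

(* The sample space: every half-edge (j, a) chooses a predecessor of j.        *)
Definition attachment (m n : nat) : Type :=
  {dffun forall p : half_edge m n, 'I_(val p.1)}.

HB.instance Definition _ m n := Finite.on (attachment m n).

Definition first_attachment m n : attachment m n :=
  [ffun p : half_edge m n => Ordinal (valP p.1)].

HB.instance Definition _ m n :=
  isPointed.Build (attachment m n) (first_attachment m n).

HB.instance Definition _ m n :=
  @isMeasurable.Build default_measure_display (attachment m n)
    discrete_measurable discrete_measurable0
    discrete_measurableC discrete_measurableU.

(* Uniform distribution on the sample space, that is, all choices are uniform  *)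
(* and independent (see uniform_attachment_indep). The second argument of      *)
(* mnormalize is a default which is irrelevant here, see uniform_attachmentE.  *)
Definition uniform_attachment (R : realType) (m n : nat) :
    probability (attachment m n) R :=
  mnormalize (@counting (attachment m n) R) (\d_(point : attachment m n)).

Definition graph (m n : nat) (w : attachment m n) : {set edge m n} :=
  [set Tagged (fun p : half_edge m n => 'I_(val p.1)) (w p)
    | p : half_edge m n]%SET.

Definition num_cycles (m l n : nat) (w : attachment m n) : nat :=
  #|[set S : {set edge m n} | (S \subset graph w) && is_cycle l S]%SET|.

Lemma measurable_num_cycles m l n :
  measurable_fun [set: attachment m n] (@num_cycles m l n).
Proof. by []. Qed.

HB.instance Definition _ m l n :=
  isMeasurableFun.Build _ _ _ _ (@num_cycles m l n)
    (@measurable_num_cycles m l n).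

(* The expectation is finite, the sample space being finite.                   *)
Definition mean_cycles (R : realType) (m l n : nat) : R :=
  fine ('E_(uniform_attachment R m n)[fun w => (num_cycles l w)%:R]).

Definition law_cycles (R : realType) (m l n : nat) : probability nat R :=
  distribution (uniform_attachment R m n) (@num_cycles m l n).

(* The second argument of poisson_prob is unused.                              *)
Definition Po (R : realType) (mu : R) : probability nat R := poisson_prob mu 0.

Definition dTV (R : realType) (nu1 nu2 : probability nat R) : \bar R :=
  ereal_sup [set `|nu1 A - nu2 A|%E | A in [set: set nat]].

Lemma uniform_attachmentE (R : realType) m n (A : {set attachment m n}) :
  uniform_attachment R m n [set` A] = (#|A|%:R / #|{: attachment m n}|%:R)%:E.
Proof.
have cE (B : {set attachment m n}) :
    @counting (attachment m n) R [set` B] = #|B|%:R%:E.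
  rewrite /counting asboolT; last exact: finite_finset.
  congr (_%:R%:E); rewrite cardE; apply: perm_size; apply: uniq_perm.
  - exact: fset_uniq.
  - exact: enum_uniq.
  - move=> x; rewrite in_fset_set ?mem_enum; last exact: finite_finset.
    by apply/idP/idP; rewrite inE.
have cT : @counting (attachment m n) R [set: attachment m n]
    = #|{: attachment m n}|%:R%:E.
  by rewrite -cardsT -cE; congr counting; apply/seteqP; split=> // x _ /=;
    rewrite inE.
rewrite /uniform_attachment /= /mnormalize /= cT /= ifF ?cE//.
rewrite orbF eqe pnatr_eq0 -cardsT; apply/negbTE.
by rewrite -lt0n; apply/card_gt0P; exists point; rewrite inE.
Qed.

Lemma uniform_attachment_indep (R : realType) m n (J : {set half_edge m n})
    (f : attachment m n) :
  uniform_attachment R m n [set w : attachment m n | forall p, p \in J -> w p = f p]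
    = (\prod_(p in J) (val p.1)%:R^-1)%:E.
Proof.
set F : forall p : half_edge m n, pred 'I_(val p.1) :=
  fun p x => (p \in J) ==> (x == f p).
have -> : [set w : attachment m n | forall p, p \in J -> w p = f p]
    = [set` [set w : attachment m n | w \in family F]%SET].
  apply/seteqP; split=> w /=; rewrite inE.
    by move=> wf; apply/familyP => p; apply/implyP => /wf ->.
  by move=> /familyP wf p pJ; have := wf p => /implyP/(_ pJ)/eqP.
rewrite uniform_attachmentE cardsE card_family card_dep_ffun.
rewrite !foldrE !big_map -!enumT !big_enum/= !natr_prod -prodf_div; congr _%:E.
rewrite [RHS]big_mkcond/=; apply: eq_bigr => p _; rewrite card_ord.
have p0 : (val p.1)%:R != 0 :> R by rewrite pnatr_eq0 -lt0n (valP p.1).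
case: ifPn => pJ.
  by rewrite (@fintype.eq_card1 _ (f p)) ?mul1r// => x; rewrite !inE /F /= pJ.
rewrite (@fintype.eq_card _ _ predT) ?card_ord ?divff// => x.
by rewrite !inE /F /= unfold_in /= (negbTE pJ).
Qed.

(* Main.v *)
(** Chen-Stein for dissociated indicators: a set of [l] edges using distinct
    half-edges is present with probability [\prod 1 / newer_end], and two
    possible cycles interact only if they share a half-edge. Since the Stein
    factor of [Po mu] is at most [1 / mu], it is enough to show that the mean
    is of order [ln n] and that the two local error terms are [O(1)].

    Both follow from one estimate on closed walks. The weight of a pair of
    vertices, counted from 1, is comparable to [K u v = 1 / max u v], which is at
    most [h u * h v] and satisfies [\sum_v K u v * h v <= 4 * h u], for
    [h u = u^(-1/2)] (Schur's test). Hence the cycles through [u] have total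
    weight [O(1 / u)], so the mean is [O(ln n)]. If a cycle shares edges with a
    given cycle [A] without being [A], each excursion out of [A] leaves from
    and returns to vertices of [A], so that the edges outside [A] have total
    weight [O(\sum_(u in A) 1 / u)]; summing over [A] leaves
    [O(\sum_u 1 / u^2)]. For the lower bound on the mean, every set of [l]
    vertices with maximum [j] carries a cycle of probability at least
    [j^(-l)]. *)
Require Import Defs.
From mathcomp Require Import all_boot all_order all_algebra.
From mathcomp Require Import all_classical all_reals all_analysis.
From mathcomp Require Import ring lra zify.

Set Implicit Arguments.
Unset Strict Implicit.
Unset Printing Implicit Defensive.

Import Order.TTheory GRing.Theory Num.Theory.
Import numFieldNormedType.Exports.
Local Open Scope ring_scope.

(** * Stein's equation for the Poisson distribution *)

Section PoissonStein.
Local Open Scope classical_set_scope.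
Variables (R : realType) (mu : R).
Hypothesis mu_gt0 : 0 < mu.

Let p k : R := poisson_pmf mu k.
Let F k : R := \sum_(i < k) p i.

Let p_gt0 k : 0 < p k.
Proof.
rewrite /p /poisson_pmf mu_gt0 !mulr_gt0 ?exprn_gt0 ?expR_gt0// invr_gt0 ltr0n fact_gt0.
Qed.

Let pS k : k.+1%:R * p k.+1 = mu * p k.
Proof.
rewrite /p /poisson_pmf mu_gt0 factS natrM exprS.
have k0 : k.+1%:R != 0 :> R by rewrite pnatr_eq0.
have kf : k`!%:R != 0 :> R by rewrite pnatr_eq0 -lt0n fact_gt0.
by move: k.+1%:R k`!%:R k0 kf => K f K0 f0; field; rewrite K0 f0.
Qed.

Let FS k : F k.+1 = F k + p k. Proof. by rewrite /F big_ord_recr. Qed.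

Let F_ge0 k : 0 <= F k. Proof. by apply: sumr_ge0 => i _; apply/ltW. Qed.

Lemma Po_prefix (A : set nat) k :
  Po mu (A `&` `I_k) = (\sum_(i < k) ((i : nat) \in A)%:R * poisson_pmf mu i)%:E.
Proof.
elim: k => [|k IH]; first by rewrite II0 setI0 measure0 big_ord0.
rewrite IIS setIUr measureU//; last first.
  by apply/seteqP; split=> i //= [[_ ik] [_ ik']]; move: ik; rewrite ik' ltnn.
rewrite big_ord_recr/= EFinD; congr (_ + _)%E; first exact: IH.
case: (boolP (k \in A)) => kA.
  rewrite mul1r setIC setIidl; last by move=> _ ->; rewrite -inE.
  by rewrite /Po /= /poisson_prob mu_gt0 esum_set1// lee_fin poisson_pmf_ge0.
rewrite mul0r (_ : A `&` _ = set0) ?measure0//.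
by apply/seteqP; split=> i //= [iA ik]; move: kA; rewrite -ik mem_set.
Qed.

Let FA (A : set nat) k : R := \sum_(i < k) ((i : nat) \in A)%:R * p i.

Let FA_ge0 A k : 0 <= FA A k.
Proof. by apply: sumr_ge0 => i _; rewrite mulr_ge0// ltW. Qed.

Let FA_le A k : FA A k <= fine (Po mu A).
Proof.
rewrite -lee_fin /FA -Po_prefix fineK ?fin_num_measure//.
by apply: le_measure; rewrite ?inE//; apply: subIsetl.
Qed.

Let FAC A k : FA A k + FA (~` A) k = F k.
Proof.
rewrite /FA -big_split/=; apply: eq_bigr => i _.
by rewrite -mulrDl in_setC; case: (_ \in A); rewrite ?addr0 ?add0r mul1r.
Qed.

Let PoC A : fine (Po mu (~` A)) = 1 - fine (Po mu A).
Proof. by rewrite probability_setC// fineB ?fin_num_measure. Qed.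

Let F_le1 k : F k <= 1.
Proof.
have := FA_le setT k; rewrite probability_setT /=; apply: le_trans.
by apply: ler_sum => i _; rewrite in_setT mul1r.
Qed.

Let F_cvg : F @ \oo --> (1 : R).
Proof.
have : (Po mu \o (fun k => `I_k)) @ \oo --> Po mu (\bigcup_k `I_k).
  apply: nondecreasing_cvg_mu => //.
  by move=> a b ab; apply/subsetPset => i /= ia; exact: leq_trans ab.
rewrite (_ : \bigcup_k _ = setT) ?probability_setT; last first.
  by apply/seteqP; split=> // i _; exists i.+1 => /=.
rewrite (_ : _ \o _ = EFin \o F); first by move/fine_cvgP => -[_].
apply/funext => k /=; rewrite -(setTI `I_k) Po_prefix; congr EFin.
by apply: eq_bigr => i _; rewrite in_setT mul1r.
Qed.

(** Each term of [F k] satisfies [mu * p i = i.+1 * p i.+1] with [i.+1 <= k]. *)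
Let mu_F_le k : mu * F k <= k%:R * F k.+1.
Proof.
elim: k => [|k IH]; first by rewrite mul0r /F big_ord0 mulr0.
rewrite FS mulrDr -pS [F k.+2]FS.
have := F_ge0 k.+1; have := p_gt0 k.+1; move: IH.
by rewrite -[k.+1%:R]natr1; nra.
Qed.

(** The same comparison on the upper tail, where [i >= k] gives [mu * p i >= k * p i.+1]; it is
    summed over a finite stretch first, and [F_cvg] then gives the limit. *)
Let tail_le k : k%:R * (1 - F k.+1) <= mu * (1 - F k).
Proof.
have H N : k%:R * (F (k + N).+1 - F k.+1) <= mu * (F (k + N) - F k).
  elim: N => [|N IH]; first by rewrite addn0 !subrr !mulr0.
  rewrite addnS [F (k + N).+2]FS [X in _ <= mu * (X - _)]FS.
  have -> : mu * (F (k + N) + p (k + N) - F k) = mu * (F (k + N) - F k)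
     + (k + N).+1%:R * p (k + N).+1 by rewrite pS; ring.
  have := p_gt0 (k + N).+1; move: IH.
  rewrite -[(k + N).+1%:R]natr1 natrD.
  have : 0 <= N%:R :> R by [].
  by nra.
have {}H N : k%:R * (F (N + k).+1 - F k.+1) <= mu * (1 - F k).
  rewrite addnC; apply: (le_trans (H N)).
  by rewrite ler_pM2l// lerD2r F_le1.
have cv : (fun N => k%:R * (F (N + k).+1 - F k.+1)) @ \oo --> k%:R * (1 - F k.+1).
  apply: cvgMr; apply: cvgB; last exact: cvg_cst.
  under eq_fun do rewrite -addnS.
  have : [sequence F (N + k.+1)%N]_N @ \oo --> (1 : R) by rewrite cvg_shiftn.
  exact.
rewrite -(cvg_lim _ cv)//; apply: limr_le; first exact: cvgP cv.
by apply: nearW.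
Qed.

Lemma poisson_stein (A : set nat) : exists f : nat -> R,
  (forall k, mu * f k.+1 - k%:R * f k = (k \in A)%:R - fine (Po mu A)) /\
  (forall k, `|f k.+2 - f k.+1| <= mu^-1).
Proof.
(* The explicit solution of Stein's equation: the covariance under the Poisson law of [A] and the
   interval from [0] to [k], divided by [mu * p k]. *)
pose g A k := (FA A k.+1 - fine (Po mu A) * F k.+1) / (mu * p k).
have mu0 : mu != 0 by rewrite gt_eqF.
have p0 k : p k != 0 by rewrite gt_eqF.
have gS B k : g B k = (FA B k.+1 - fine (Po mu B) * F k.+1) / (k.+1%:R * p k.+1).
  by rewrite pS.
have k0 k : k.+1%:R != 0 :> R by rewrite pnatr_eq0.
have gle B k : g B k.+1 - g B k <= mu^-1.
  rewrite (gS B k) /g; set q := fine _.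
  have := FA_le B k.+2; rewrite -/q => h2.
  set a := FA B k.+1; set pk := p k.+1; set s := F k.+1.
  have eFA : FA B k.+2 = a + (k.+1 \in B)%:R * pk by rewrite /FA big_ord_recr.
  have eF : F k.+2 = s + pk by rewrite FS.
  have ha : 0 <= a := FA_ge0 _ _.
  have := tail_le k.+1; rewrite eF -/s.
  have := mu_F_le k.+1; rewrite eF -/s.
  have pk0 : 0 < pk := p_gt0 _.
  have kk : 0 < k.+1%:R :> R by rewrite ltr0n.
  have e1 : 0 <= ((k.+1 \in B)%:R : R) <= 1 by case: (_ \in B); rewrite /= ?lexx ?ler01.
  have s1 : 0 <= s := F_ge0 _.
  have s2 : s + pk <= 1 by rewrite -eF.
  move: h2 kk e1; rewrite eFA.
  have K0 := k0 k; have P0 : pk != 0 := p0 _.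
  set c : R := (_ \in B)%:R; move: k.+1%:R K0 => K K0 h2 kk /andP[c0 c1] h3 h4.
  rewrite -subr_ge0.
  have -> : mu^-1 - ((a + c * pk - q * (s + pk)) / (mu * pk)
     - (a - q * s) / (K * pk)) =
   (K * pk - (K * (a + c * pk - q * (s + pk)) - mu * (a - q * s))) / (K * pk * mu).
    by field; rewrite K0 P0 mu0.
  rewrite divr_ge0//; last by rewrite !mulr_ge0// ltW.
  (* Here [a] is the mass of [B] up to [k], [b] its mass beyond [k.+1], and [c] the indicator of
     [k.+1] in [B]. The numerator is exactly [G1 + G2 + G3 + G4], nonnegative by [tail_le], by
     [mu_F_le] twice and by [c <= 1]. *)
  pose b := q - (a + c * pk).
  have hb : 0 <= b by rewrite subr_ge0.
  have -> : q = a + c * pk + b by rewrite /b; ring.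
  have G1 : 0 <= a * (mu * (1 - s) - K * (1 - (s + pk))).
    by rewrite mulr_ge0// subr_ge0.
  have G2 : 0 <= b * (K * (s + pk) - mu * s) by rewrite mulr_ge0// subr_ge0.
  have G3 : 0 <= c * pk * (K * (s + pk) - mu * s).
    by rewrite mulr_ge0 ?mulr_ge0 ?subr_ge0// ltW.
  have G4 : 0 <= (1 - c) * (K * pk) by rewrite !mulr_ge0 ?subr_ge0// ltW.
  move: G1 G2 G3 G4; lra.
(* Complementing the set changes the sign of [g], so the one-sided bound [gle] also controls
   decrements. *)
have gC B k : g (~` B) k = - g B k.
  rewrite /g PoC -[in RHS]mulNr; congr (_ / _).
  by rewrite -(FAC B k.+1); ring.
(* The equation only sees [f 0] multiplied by [0], so [0] is a default value; the increment bound
   starts at [f 1]. *)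
exists (fun k => if k is k'.+1 then g A k' else 0); split=> [k|k].
  case: k => [|k].
    rewrite mul0r subr0 /g /FA /F !big_ord_recl !big_ord0 !addr0.
    by field; rewrite mu0 p0.
  rewrite (gS A k) /g; have -> : FA A k.+2 = FA A k.+1 + (k.+1 \in A)%:R * p k.+1.
    by rewrite /FA big_ord_recr.
  rewrite [F k.+2]FS; move: (k0 k) (p0 k.+1).
  by move: k.+1%:R (p k.+1) => K P K0 P0; field; rewrite mu0 K0 P0.
rewrite ler_norml gle andbT lerNl opprB.
by have := gle (~` A) k; rewrite !gC opprK addrC.
Qed.

End PoissonStein.

(* For the lemma names that [classical_sets] shadows. *)
From mathcomp Require Import fintype finset.

(** * The Chen-Stein bound *)

Section FiniteMean.
Variables (R : realFieldType) (Omega : finType).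

Definition mean (phi : Omega -> R) : R := (\sum_w phi w) / #|Omega|%:R.

Lemma eq_mean phi psi : phi =1 psi -> mean phi = mean psi.
Proof. by move=> e; congr (_ / _); apply: eq_bigr => w _. Qed.

Lemma meanB phi psi : mean (fun w => phi w - psi w) = mean phi - mean psi.
Proof. by rewrite /mean sumrB mulrBl. Qed.

Lemma meanZ c phi : mean (fun w => c * phi w) = c * mean phi.
Proof. by rewrite /mean -big_distrr mulrA. Qed.

Lemma mean_sum (I : finType) (P : pred I) (F : I -> Omega -> R) :
  mean (fun w => \sum_(i | P i) F i w) = \sum_(i | P i) mean (F i).
Proof. by rewrite /mean exchange_big mulr_suml. Qed.

Lemma mean_ge0 phi : (forall w, 0 <= phi w) -> 0 <= mean phi.
Proof. by move=> h; rewrite mulr_ge0 ?invr_ge0// sumr_ge0. Qed.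

Lemma mean_norm_le phi psi :
  (forall w, `|phi w| <= psi w) -> `|mean phi| <= mean psi.
Proof.
move=> h; rewrite normrM [`|_^-1|]ger0_norm ?invr_ge0// ler_wpM2r ?invr_ge0//.
by apply: le_trans (ler_norm_sum _ _ _) _; exact: ler_sum.
Qed.

Lemma mean_cst (c : R) : (0 < #|Omega|)%N -> mean (fun=> c) = c.
Proof.
move=> O0; rewrite /mean sumr_const -[c *+ _]mulr_natr mulfK//.
by rewrite pnatr_eq0 -lt0n.
Qed.

(* [f (V w).+1], with [V] the sum over the indices not related to [i], is    *)
(* inserted between the two terms: by independence its contributions cancel. *)
Lemma chen_stein (I : finType) (P : pred I) (X : I -> Omega -> bool)
    (nbr : rel I) (c : R) (f : nat -> R) :
  let W w := (\sum_(i | P i) X i w)%N in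
  let p i := mean (fun w => (X i w)%:R) in
  (forall i, P i -> nbr i i) ->
  (forall i (g : nat -> R), P i ->
    let V w := (\sum_(j | P j && ~~ nbr i j) X j w)%N in
    mean (fun w => (X i w)%:R * g (V w)) = p i * mean (fun w => g (V w))) ->
  (forall k, `|f k.+2 - f k.+1| <= c) ->
  `|mean (fun w => (\sum_(i | P i) p i) * f (W w).+1 - (W w)%:R * f (W w))|
   <= c * \sum_(i | P i) (\sum_(j | P j && nbr i j) p i * p j
        + \sum_(j | P j && (nbr i j && (j != i)))
            mean (fun w => (X i w && X j w)%:R)).
Proof.
move=> W p nbri indep flip.
have c0 : 0 <= c := le_trans (normr_ge0 _) (flip 0).
have lip a b : `|f (a + b).+1 - f a.+1| <= c * b%:R.
  elim: b => [|b IH]; first by rewrite addn0 subrr normr0 mulr0.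
  rewrite -natr1 mulrDr mulr1 -(subrKA (f (a + b).+1)).
  by apply: (le_trans (ler_normD _ _)); rewrite addrC lerD// addnS.
(* [W] splits into unrelated indices ([V]) and related ones ([Y]), and [Y] into [i] itself and the
   rest ([Z]). The products of means come from [Y], the joint probabilities from [Z]. *)
pose V i w := (\sum_(j | P j && ~~ nbr i j) X j w)%N.
pose Y i w := (\sum_(j | P j && nbr i j) X j w)%N.
pose Z i w := (\sum_(j | P j && (nbr i j && (j != i))) X j w)%N.
have WE i w : W w = (V i w + Y i w)%N by rewrite /W (bigID (nbr i)) addnC.
have YE i w : P i -> Y i w = (X i w + Z i w)%N.
  move=> Pi; rewrite /Y (bigD1 i) ?Pi ?nbri//=; congr addn.
  by apply: eq_bigl => j; rewrite andbA.
have -> : mean (fun w => (\sum_(i | P i) p i) * f (W w).+1 - (W w)%:R * f (W w)) =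
  \sum_(i | P i) (mean (fun w => p i * (f (W w).+1 - f (V i w).+1))
     + mean (fun w => (X i w)%:R * (f (V i w).+1 - f (W w)))).
  have E i : P i -> mean (fun w => p i * f (V i w).+1) =
     mean (fun w => (X i w)%:R * f (V i w).+1).
    by move=> Pi; rewrite meanZ (indep i (fun k => f k.+1)).
  transitivity (mean (fun w => \sum_(i | P i) (p i * f (W w).+1 - (X i w)%:R * f (W w)))).
    by apply: eq_mean => w; rewrite sumrB -!mulr_suml natr_sum.
  rewrite mean_sum; apply: eq_bigr => i Pi /=.
  under [X in _ = X + _]eq_mean do rewrite mulrBr.
  under [X in _ = _ + X]eq_mean do rewrite mulrBr.
  by rewrite !meanB E// addrA subrK.
apply: (le_trans (ler_norm_sum _ _ _)); rewrite mulr_sumr; apply: ler_sum => i Pi.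
apply: (le_trans (ler_normD _ _)); rewrite mulrDr; apply: lerD.
  rewrite -mulr_sumr meanZ normrM.
  have p0 : 0 <= p i by apply: mean_ge0.
  rewrite ger0_norm// mulrCA ler_wpM2l// -mean_sum -meanZ.
  by apply: mean_norm_le => w; rewrite (WE i) -natr_sum; exact: lip.
rewrite -mean_sum -meanZ; apply: mean_norm_le => w; rewrite -natr_sum.
(* Where [X i] fails the left side vanishes; where it holds, [W = V + 1 + Z], so the two arguments
   of [f] differ by [Z] alone. *)
case Xi: (X i w); last by rewrite mul0r normr0 mulr_ge0.
rewrite mul1r distrC (WE i) YE// Xi addnCA add1n; exact: lip.
Qed.

End FiniteMean.

(** * The graph as a product space *)

Section Independence.
Variables (R : realFieldType) (I : finType) (T_ : I -> finType).
Local Notation Omega := {dffun forall i : I, T_ i}.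

Let mix (J : pred I) (w w' : Omega) : Omega :=
  [ffun i => if J i then w i else w' i].

(* Exchanging the coordinates in [J] of two independent copies preserves the *)
(* uniform distribution on pairs.                                            *)
Lemma mean_indep (J : pred I) (phi psi : Omega -> R) :
  (0 < #|Omega|)%N ->
  (forall w w' : Omega, (forall i, J i -> w i = w' i) -> phi w = phi w') ->
  (forall w w' : Omega, (forall i, ~~ J i -> w i = w' i) -> psi w = psi w') ->
  mean (fun w => phi w * psi w) = mean phi * mean psi.
Proof.
move=> O0 phiJ psiJ.
have N0 : #|Omega|%:R != 0 :> R by rewrite pnatr_eq0 -lt0n.
suff : (\sum_w phi w) * (\sum_w psi w) = #|Omega|%:R * \sum_w phi w * psi w.
  by rewrite /mean mulf_div => ->; rewrite -mulf_div divff// mul1r.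
have mixK w w' : mix J (mix J w w') (mix J w' w) = w.
  by apply/ffunP => i; rewrite !ffunE; case: (J i).
pose s (x : Omega * Omega) := (mix J x.1 x.2, mix J x.2 x.1).
have sK : involutive s by case=> a b; rewrite /s /= !mixK.
rewrite big_distrlr/= pair_big/= (reindex_inj (inv_inj sK))/=.
transitivity (\sum_(x : Omega * Omega) phi x.1 * psi x.1).
  apply: eq_bigr => -[a b] _ /=; congr (_ * _).
    by apply: phiJ => i Ji; rewrite ffunE Ji.
  by apply: psiJ => i Ji; rewrite ffunE (negbTE Ji).
rewrite -(pair_big xpredT xpredT (fun x _ => phi x * psi x))/=.
under eq_bigr do rewrite sumr_const.
by rewrite mulr_sumr; apply: eq_bigr => w _; rewrite mulr_natl.
Qed.
End Independence.

Section Attachment.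
Variables (R : realType) (m n : nat).
Implicit Types (S T : {set edge m n}) (e : edge m n) (w : attachment m n).

Lemma attachment_gt0 : (0 < #|{: attachment m n}|)%N.
Proof. by apply/card_gt0P; exists (first_attachment m n). Qed.

Lemma mem_graph w e : (e \in graph w) = (Tagged _ (w (tag e)) == e).
Proof.
apply/imsetP/eqP => [[p _ ->]//|<-]; by exists (tag e).
Qed.

(** Vertices being numbered from [0], the index of the newer end is the number of its possible
    targets, so this is the probability of a single edge. *)
Definition wt e : R := (newer_end e)%:R^-1.
Definition pr S : R := mean (fun w => (S \subset graph w)%:R).

Lemma wt_ge0 e : 0 <= wt e. Proof. by rewrite invr_ge0. Qed.
Lemma pr_ge0 S : 0 <= pr S. Proof. exact: mean_ge0. Qed.

Lemma mean_mem_graph e : mean (fun w => (e \in graph w)%:R) = wt e.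
Proof.
case: e => p0 i0; set e : edge m n := existT _ p0 i0.
set F : forall p : half_edge m n, pred 'I_(val p.1) :=
  fun p x => (p == tag e) ==> (Tagged (fun p : half_edge m n => 'I_(val p.1)) x == e).
have -> : mean (fun w => (e \in graph w)%:R) =
    #|(family F : {pred attachment m n})|%:R / #|{: attachment m n}|%:R :> R.
  rewrite /mean; congr (_ / _); rewrite -sum1_card natr_sum [RHS]big_mkcond.
  apply: eq_bigr => w _; rewrite mem_graph.
  suff -> : (Tagged _ (w (tag e)) == e) = (w \in family F) by case: (_ \in _).
  apply/idP/familyP => [h p|/(_ (tag e))]; last by rewrite unfold_in /F eqxx.
  by rewrite unfold_in /F; apply/implyP => /eqP ->.
rewrite card_family card_dep_ffun.
rewrite !foldrE !big_map -!enumT !big_enum/= !natr_prod -prodf_div.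
rewrite (bigD1 (tag e))//= [X in _ * X]big1 => [|p pe]; last first.
  rewrite (@eq_card _ _ predT); last first.
    by move=> x; rewrite !inE /F /= unfold_in /= (negbTE pe).
  by rewrite card_ord divff// pnatr_eq0 -lt0n (valP p.1).
rewrite mulr1 card_ord (@eq_card1 _ (tagged e)) ?mul1r// => x.
rewrite !inE /F /= unfold_in /= eqxx.
exact: (@eq_Tagged _ (fun p : half_edge m n => 'I_(val p.1) : eqType)).
Qed.

Lemma pr_conflict S e e' :
  e \in S -> e' \in S -> tag e = tag e' -> e != e' -> pr S = 0.
Proof.
move=> eS e'S tt ne; rewrite /pr (@eq_mean _ _ _ (fun=> 0)) ?mean_cst ?attachment_gt0//.
move=> w; case: (boolP (_ \subset _)) => // /subsetP h.
have := h _ eS; have := h _ e'S; rewrite !mem_graph -tt => /eqP a /eqP b.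
by move: ne; rewrite -a -b eqxx.
Qed.

Lemma pr_setU1 S e : (forall e', e' \in S -> tag e' != tag e) ->
  pr (e |: S) = wt e * pr S.
Proof.
move=> h; rewrite -mean_mem_graph /pr -(@mean_indep _ _ _ (pred1 (tag e))) ?attachment_gt0//.
- by apply: eq_mean => w; rewrite subUset sub1set -natrM mulnb.
- by move=> w w' ww'; rewrite !mem_graph ww' //=.
- move=> w w' ww'; congr ((_ : bool)%:R).
  by apply/subsetP/subsetP => H e' e'S; have := H _ e'S;
    rewrite !mem_graph ww'//= h.
Qed.

Lemma pr0 : pr set0 = 1.
Proof.
rewrite /pr (@eq_mean _ _ _ (fun=> 1)) ?mean_cst ?attachment_gt0// => w.
by rewrite sub0set.
Qed.

(** Either [e] reuses a half-edge of [S] and the union is impossible, or [e] is independent of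
    [S]. *)
Lemma pr_setU1_le S e : e \notin S -> pr (e |: S) <= wt e * pr S.
Proof.
move=> eS; case: (boolP [exists e' in S, tag e' == tag e]) => [/existsP[e' /andP[e'S /eqP t]]|].
  have ne : e != e' by apply: contraNneq eS => ->.
  rewrite (@pr_conflict _ e e' _ _ (esym t) ne) ?setU11 ?setU1r//.
  by rewrite mulr_ge0 ?wt_ge0 ?pr_ge0.
rewrite negb_exists => /forallP h; rewrite pr_setU1// => e' e'S.
by have := h e'; rewrite e'S.
Qed.

Lemma prU_le S T : pr (S :|: T) <= pr S * \prod_(e in T :\: S) wt e.
Proof.
have [k kE] := ubnP #|T :\: S|; elim: k => // k IH in T kE *.
have [/eqP TS|/set0Pn[e]] := boolP (T :\: S == set0)%SET.
  by rewrite TS big_set0 mulr1 (setUidPl _)// -setD_eq0 TS.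
move=> eTS; rewrite (big_setD1 e)//=.
have -> : (S :|: T = e |: (S :|: T :\ e))%SET.
  by rewrite setUCA setD1K//; move: eTS; rewrite inE => /andP[].
move: (eTS); rewrite inE => /andP[eS eT].
apply: le_trans (pr_setU1_le _) _; first by rewrite !inE eqxx (negbTE eS).
rewrite [leRHS]mulrCA ler_wpM2l ?wt_ge0//.
have E : ((T :\: S) :\ e = (T :\ e) :\: S)%SET by rewrite !setDDl setUC.
rewrite E; apply: IH; rewrite -E.
by move: kE; rewrite (cardsD1 e) eTS add1n ltnS.
Qed.

Lemma pr_le S : pr S <= \prod_(e in S) wt e.
Proof. by have := prU_le set0 S; rewrite set0U setD0 pr0 mul1r. Qed.

Lemma pr_inj S : {in S &, injective (@tag _ _ : edge m n -> half_edge m n)} ->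
  pr S = \prod_(e in S) wt e.
Proof.
have [k kE] := ubnP #|S|; elim: k => // k IH in S kE * => h.
have [->|[e eS]] := set_0Vmem S; first by rewrite big_set0 pr0.
rewrite (big_setD1 e)//= -IH.
- rewrite -pr_setU1 ?setD1K// => e'; rewrite !inE => /andP[ne e'S].
  by apply: contraNneq ne => t; apply/eqP/h.
- by move: kE; rewrite (cardsD1 e) eS add1n ltnS.
- by move=> a b /setD1P[_ aS] /setD1P[_ bS]; exact: h.
Qed.

Lemma num_cyclesE l w :
  num_cycles l w = (\sum_(S : {set edge m n} | is_cycle l S) (S \subset graph w))%N.
Proof.
rewrite /num_cycles -sum1_card big_mkcond [RHS]big_mkcond.
by apply: eq_bigr => S _; rewrite inE andbC; case: is_cycle => //=; case: (_ \subset _).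
Qed.

(** The dependency relation. It compares half-edges rather than edges, because two different edges
    on one half-edge exclude each other. *)
Definition linked : rel {set edge m n} :=
  fun S T => [exists e in S, tag e \in [set tag e' | e' in T]%SET].

(** The presence of [S] depends only on the choices of the half-edges of [S], and [V] only on the
    other choices. *)
Lemma linked_indep l S (g : nat -> R) :
  let V w := (\sum_(T | is_cycle l T && ~~ linked S T) (T \subset graph w))%N in
  mean (fun w => (S \subset graph w)%:R * g (V w)) = pr S * mean (fun w => g (V w)).
Proof.
move=> V; apply: (@mean_indep _ _ _ [pred p | p \in [set tag e | e in S]%SET]).
- exact: attachment_gt0.
- move=> w w' ww'; congr ((_ : bool)%:R).
  by apply/subsetP/subsetP => H e eS; have := H _ eS;
    rewrite !mem_graph ww'//=; apply: imset_f.
- move=> w w' ww'; congr g; apply: eq_bigr => T /andP[_ nST]; congr (nat_of_bool _).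
  have a e : e \in T -> w (tag e) = w' (tag e).
    move=> eT; apply: ww' => /=; apply: contra nST => /imsetP[e' e'S t].
    by apply/existsP; exists e'; rewrite e'S -t imset_f.
  by apply/subsetP/subsetP => H e eS; have := H _ eS; rewrite !mem_graph a.
Qed.

(* [b1 + b2] in the usual notation for the Chen-Stein bound. *)
Definition local_error l : R :=
  \sum_(S : {set edge m n} | is_cycle l S)
    (\sum_(T | is_cycle l T && linked S T) pr S * pr T
     + \sum_(T | is_cycle l T && (linked S T && (T != S)))
         mean (fun w => ((S \subset graph w) && (T \subset graph w))%:R)).

End Attachment.

(** * From probability laws to finite averages *)

Section Laws.
Local Open Scope classical_set_scope.
Variables (R : realType) (m l n : nat).

Lemma uniform_attachment_mean (b : pred (attachment m n)) :
  uniform_attachment R m n [set w | b w] = (mean (fun w => (b w)%:R))%:E.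
Proof.
have -> : [set w | b w] = [set` [set w | b w]%SET].
  by apply/seteqP; split => w /=; rewrite inE.
rewrite uniform_attachmentE; congr (_ / _)%:E.
rewrite -sum1_card natr_sum big_mkcond; apply: eq_bigr => w _.
by rewrite inE; case: (b w).
Qed.

Lemma law_cyclesE (A : set nat) :
  law_cycles R m l n A = (mean (fun w : attachment m n => (num_cycles l w \in A)%:R))%:E.
Proof.
rewrite -uniform_attachment_mean /law_cycles /distribution /= /pushforward.
by congr (uniform_attachment _ _ _ _); apply/seteqP; split => w /=;
  [exact: mem_set|exact: set_mem].
Qed.

Lemma mean_cyclesE : mean_cycles R m l n =
  \sum_(S : {set edge m n} | is_cycle l S) pr R S.
Proof.
rewrite /mean_cycles unlock.
rewrite (eq_integral (fun w : attachment m n =>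
   \sum_(S <- enum [pred S : {set edge m n} | is_cycle l S])
      (\1_[set w : attachment m n | S \subset graph w] w)%:E)%E); last first.
  move=> w _; rewrite sumEFin big_enum/= num_cyclesE natr_sum; congr EFin.
  apply: eq_bigr => S _; rewrite indicE.
  by case: (boolP (S \subset graph w)) => h; [rewrite mem_set|rewrite memNset//; exact/negP].
rewrite ge0_integral_sum//.
rewrite (eq_bigr (fun S => (pr R S)%:E)) => [|S _].
  by rewrite sumEFin big_enum.
rewrite integral_indic// classical_sets.setIT.
exact: (uniform_attachment_mean (fun w => S \subset graph w)).
Qed.

End Laws.

(** Averaging Stein's equation at the number of cycles turns the discrepancy on [A] into the
    quantity bounded by [chen_stein]. A cycle is linked to itself because it has an edge. *)
Lemma dTV_le (R : realType) (m l n : nat) (c : R) : 0 < mean_cycles R m l n ->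
  local_error R m n l <= c ->
  (0 < l)%N ->
  (dTV (law_cycles R m l n) (Po (mean_cycles R m l n))
    <= ((mean_cycles R m l n)^-1 * c)%:E)%E.
Proof.
move=> mu0 err l0; apply: ge_ereal_sup => _ [A _ <-].
have [f [fE flip]] := poisson_stein mu0 A.
have refl (S : {set edge m n}) : is_cycle l S -> linked S S.
  move=> /existsP[v /existsP[e /and4P[_ _ _ /eqP ->]]].
  apply/existsP; exists (e (Ordinal l0)).
  by rewrite !imset_f.
have := chen_stein (X := fun (S : {set edge m n}) (w : attachment m n) => S \subset graph w)
  refl (fun S g cS => linked_indep l S g) flip.
rewrite -/(pr R _) -mean_cyclesE.
set mu := mean_cycles R m l n in mu0 fE *.
have -> : mean (fun w : attachment m n => mu *
     f (\sum_(S | is_cycle l S) (S \subset graph w))%N.+1 -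
   (\sum_(S | is_cycle l S) (S \subset graph w))%:R *
     f (\sum_(S | is_cycle l S) (S \subset graph w))%N) =
   mean (fun w : attachment m n => (num_cycles l w \in A)%:R) - fine (Po mu A).
  rewrite -[X in _ - X](@mean_cst R _ _ (attachment_gt0 m n)) -meanB.
  by apply: eq_mean => w; rewrite -num_cyclesE fE.
move=> h.
rewrite law_cyclesE -[Po mu A]fineK ?fin_num_measure// -EFinB abse_EFin lee_fin.
apply: (le_trans h); rewrite ler_wpM2l// invr_ge0 ltW//.
Qed.

(** * Weighted closed walks *)

Section Kernel.
Variable R : rcfType.

Definition hw (u : nat) : R := (Num.sqrt u.+1%:R)^-1.
Definition kw (u v : nat) : R := (maxn u v).+1%:R^-1.

Lemma hw_gt0 u : 0 < hw u.
Proof. by rewrite invr_gt0 sqrtr_gt0 ltr0n. Qed.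
Lemma hw_ge0 u : 0 <= hw u. Proof. exact/ltW/hw_gt0. Qed.
Lemma hw_le1 u : hw u <= 1.
Proof.
by rewrite invf_le1 ?sqrtr_gt0 ?ltr0n// -[leLHS]sqrtr1 ler_wsqrtr// ler1n.
Qed.
Lemma kw_ge0 u v : 0 <= kw u v. Proof. by rewrite invr_ge0. Qed.

Lemma hw_sqr u : hw u ^+ 2 = u.+1%:R^-1.
Proof. by rewrite exprVn sqr_sqrtr. Qed.

Lemma kw_le_hw u v : kw u v <= hw u * hw v.
Proof.
rewrite -[leLHS](@ger0_norm _ (kw u v)) ?kw_ge0//.
rewrite -[leRHS](@ger0_norm _ (hw u * hw v)) ?mulr_ge0 ?hw_ge0//.
rewrite -ler_sqr ?nnegrE// ?sqr_normr !real_normK ?num_real// exprMn !hw_sqr exprVn.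
rewrite -invfM lef_pV2 ?posrE ?exprn_gt0 ?mulr_gt0 ?ltr0n// expr2.
by rewrite -!natrM ler_nat leq_mul// ltnS ?leq_maxl ?leq_maxr.
Qed.

Lemma sum_hw_le k : \sum_(i < k) hw i <= 2 * Num.sqrt k%:R.
Proof.
elim: k => [|k IH]; first by rewrite big_ord0 sqrtr0 mulr0.
rewrite big_ord_recr/=; apply: le_trans (lerD IH (lexx _)) _.
have a0 : 0 <= Num.sqrt (k%:R : R) by rewrite sqrtr_ge0.
have b0 : 0 < Num.sqrt (k.+1%:R : R) by rewrite sqrtr_gt0 ltr0n.
have ae : Num.sqrt (k%:R : R) ^+ 2 = k%:R by rewrite sqr_sqrtr.
have be : Num.sqrt (k.+1%:R : R) ^+ 2 = k%:R + 1 by rewrite sqr_sqrtr// natr1.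
rewrite /hw; move: ae be a0 b0; set a := Num.sqrt _; set b := Num.sqrt _.
move=> ae be a0 b0.
rewrite -(ler_pM2r b0) mulrDl mulVf ?gt_eqF//.
have := sqr_ge0 (b - a); rewrite sqrrB ae be => h.
have bb : b * b = k%:R + 1 by rewrite -expr2.
rewrite -!mulrA bb [a * b]mulrC; lra.
Qed.

(* [(v+1)^(-3/2)] telescopes against [v^(-1/2)]. *)
Lemma sum_hw_tail n u : \sum_(i < n | (u < i)%N) kw u i * hw i <= 2 * hw u.
Proof.
suff : \sum_(i < n | (u < i)%N) kw u i * hw i <=
   if (u < n)%N then 2 * hw u - 2 * hw n.-1 else 0.
  move/le_trans; apply; case: ifP => _; last by rewrite mulr_ge0 ?hw_ge0.
  by rewrite gerBl mulr_ge0 ?hw_ge0.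
elim: n => [|n IH]; first by rewrite big_ord0.
rewrite big_mkcond big_ord_recr -big_mkcond /= ltnS.
apply: le_trans (lerD IH (lexx _)) _.
case: (ltngtP u n) => un; last by rewrite un subrr addr0.
  case: n un {IH} => // n un /=.
  rewrite -lerBrDl.
  have -> : 2 * hw u - 2 * hw n.+1 - (2 * hw u - 2 * hw n) =
      2 * hw n - 2 * hw n.+1 by ring.
  rewrite /kw; have -> : maxn u n.+1 = n.+1 by lia.
  rewrite -hw_sqr.
  have a0 := hw_gt0 n; have b0 := hw_gt0 n.+1.
  have : (hw n)^-1 ^+ 2 + 1 = (hw n.+1)^-1 ^+ 2.
    by rewrite (exprVn (hw n)) (exprVn (hw n.+1)) !hw_sqr !invrK natr1.
  move: a0 b0; rewrite -(invr_gt0 (hw n)) -(invr_gt0 (hw n.+1));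
  set a := (hw n)^-1; set b := (hw n.+1)^-1.
  rewrite -[hw n]invrK -[hw n.+1]invrK -/a -/b => a0 b0 e.
  have -> : (b^-1) ^+ 2 / b = 1 / (b^+3) by field; rewrite gt_eqF.
  have -> : 2 / a - 2 / b = 2 * (b - a) / (a * b) by field; rewrite !gt_eqF.
  rewrite ler_pdivrMr ?exprn_gt0// mulrAC ler_pdivlMr ?mulr_gt0//.
  have ab : a <= b.
    have : a ^+ 2 <= b ^+ 2 by rewrite -e lerDl.
    by rewrite ler_sqr ?nnegrE ?(ltW a0) ?(ltW b0).
  have e' : (b - a) * (b + a) = 1 by rewrite -subr_sqr -e; ring.
  have -> : 1 * (a * b) = (b - a) * ((b + a) * a * b) by rewrite -[in LHS]e'; ring.
  have -> : 2 * (b - a) * b ^+ 3 = (b - a) * (2 * b ^+ 3) by ring.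
  rewrite ler_wpM2l ?subr_ge0//.
  have : (b + a) * a <= 2 * b ^+2.
    rewrite expr2 mulrA ler_pM ?addr_ge0 ?(ltW a0) ?(ltW b0)//.
    by rewrite mulrDl !mul1r lerD2l.
  by rewrite -(ler_pM2r b0) => /le_trans; apply; rewrite exprS; lra.
by rewrite addr0.
Qed.

(** Vertices newer than [u] contribute at most [2 * hw u] by [sum_hw_tail]. On the others the kernel
    is constantly [1 / u.+1], and [sum_hw_le] gives [2 * hw u] again. *)
Lemma kernel_hw n u : \sum_(v < n) kw u v * hw v <= 4 * hw u.
Proof.
rewrite (bigID (fun v : 'I_n => (u < v)%N))/=.
rewrite (_ : 4 = 2 + 2); last by ring.
rewrite mulrDl lerD ?sum_hw_tail//.
apply: (@le_trans _ _ (\sum_(v < u.+1) (u.+1)%:R^-1 * hw v)).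
  pose G (i : nat) := u.+1%:R^-1 * hw i.
  rewrite -(big_mkord (fun i => ~~ (u < i)%N) (fun i => kw u i * hw i)).
  rewrite -(big_mkord xpredT G).
  rewrite [leLHS](eq_bigr G); last first.
    by move=> i /=; rewrite -leqNgt => iu; rewrite /kw /G; have -> : maxn u i = u by lia.
  have G0 i : 0 <= G i by apply: mulr_ge0; [rewrite invr_ge0|exact: hw_ge0].
  case: (leqP n u.+1) => nu.
    rewrite [leRHS](@big_cat_nat _ _ _ n)//= -[leLHS]addr0 lerD ?sumr_ge0//.
    by rewrite [leLHS]big_mkcond; apply: ler_sum => i _; case: ifP.
  rewrite (@big_cat_nat _ _ _ u.+1)//= ?(ltnW nu)// -[leRHS]addr0 lerD//.
    by rewrite [leLHS]big_mkcond; apply: ler_sum => i _; case: ifP.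
  by rewrite big_nat_cond big1// => i /andP[]; lia.
rewrite -big_distrr/=; apply: (le_trans (ler_wpM2l _ (sum_hw_le _))).
  by rewrite invr_ge0.
by rewrite -hw_sqr mulrCA ler_pM2l ?ltr0n// expr2 -mulrA mulVf ?mulr1.
Qed.

Lemma sum_inv_sqr n : \sum_(i < n) (i.+1%:R ^- 2 : R) <= 2.
Proof.
case: n => [|n]; first by rewrite big_ord0.
suff : \sum_(i < n.+1) (i.+1%:R ^- 2 : R) <= 2 - n.+1%:R^-1.
  by move/le_trans; apply; rewrite gerBl invr_ge0.
elim: n => [|n IH]; first by rewrite big_ord1 expr1n invr1; lra.
rewrite big_ord_recr/=; apply: le_trans (lerD IH (lexx _)) _.
rewrite -subr_ge0 -[n.+2%:R]natr1.
have : (0 : R) < n.+1%:R by rewrite ltr0n.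
move: n.+1%:R => x x0.
have -> : 2 - (x + 1)^-1 - (2 - x^-1 + (x + 1) ^- 2) = (x * (x + 1) ^+ 2)^-1.
  by field; rewrite !gt_eqF// ltr_wpDl// ltW.
by rewrite invr_ge0 mulr_ge0 ?exprn_ge0 ?addr_ge0 ?ltW.
Qed.
End Kernel.

(** * Sums over walks with step-dependent weights *)

Section Walks.
Variables (R : realFieldType) (V : finType) (M : nat -> V -> V -> R).
Hypothesis M_ge0 : forall i a b, 0 <= M i a b.

(** The walk is open with [k] steps; [f] sees both of its ends and serves to carry the step that
    closes it. *)
Definition walk_sum k (f : V -> V -> R) : R :=
  \sum_(v : {ffun 'I_k.+1 -> V})
    (\prod_(i < k) M i (v (inord i)) (v (inord i.+1))) * f (v ord0) (v ord_max).

Lemma walk_sumS k f :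
  walk_sum k.+1 f = walk_sum k (fun a b => \sum_c M k b c * f a c).
Proof.
rewrite /walk_sum; under [RHS]eq_bigr do rewrite mulr_sumr.
rewrite pair_big/=.
pose ext (x : {ffun 'I_k.+1 -> V} * V) : {ffun 'I_k.+2 -> V} :=
  [ffun i : 'I_k.+2 => if (i < k.+1)%N then x.1 (inord i) else x.2].
pose res (v : {ffun 'I_k.+2 -> V}) : {ffun 'I_k.+1 -> V} * V :=
  ([ffun i : 'I_k.+1 => v (inord i)], v ord_max).
have extK : cancel ext res.
  move=> [v c]; rewrite /res /ext /= !ffunE /= ltnn; congr (_, _).
  by apply/ffunP => i; rewrite !ffunE inordK ?ltn_ord ?inord_val// ltnW// ltnS.
have resK : cancel res ext.
  move=> v; apply/ffunP => i; rewrite /ext /res ffunE /=; case: ifP => ik.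
    by rewrite ffunE; congr (v _); apply/val_inj; rewrite /= inordK ?inordK// ltnW.
  by congr (v _); apply/val_inj => /=; have := ltn_ord i; lia.
rewrite (reindex ext); last by exists res => x _; [exact: extK|exact: resK].
apply: eq_bigr => -[v c] _; rewrite big_ord_recr/= mulrA.
congr (_ * _ * _).
- apply: eq_bigr => i _; have ik := ltn_ord i.
  by rewrite !ffunE /= !inordK ?(ltnW ik) ?ltnS ?ik// ltnW// ltnW// ltnS.
- rewrite !ffunE !inordK//= ltnSn ltnn; congr (M k (v _) _).
  by apply/val_inj; rewrite /= inordK.
- rewrite !ffunE /= ltnn; congr (f (v _) _).
  by apply/val_inj; rewrite /= inordK.
Qed.

Lemma walk_sum_le k f g : (forall a b, f a b <= g a b) ->
  walk_sum k f <= walk_sum k g.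
Proof.
by move=> fg; apply: ler_sum => v _; rewrite ler_wpM2l// prodr_ge0.
Qed.

(** [g j a b] bounds the weight of completing a walk that started at [a] and stands at [b] after [j]
    steps. Summing out the last vertex repeatedly ends with walks of no step, where [a] and [b]
    coincide. *)
Lemma walk_sum_bound k (g : nat -> V -> V -> R) :
  (forall j a b, (j < k)%N -> \sum_c M j b c * g j.+1 a c <= g j a b) ->
  walk_sum k (g k) <= \sum_a g 0 a a.
Proof.
elim: k => [|k IH] h.
  rewrite /walk_sum (reindex (fun a : V => [ffun=> a] : {ffun 'I_1 -> V})).
    by apply: ler_sum => a _; rewrite big_ord0 mul1r !ffunE.
  exists (fun v : {ffun 'I_1 -> V} => v ord0) => [a _|v _]; first by rewrite ffunE.
  by apply/ffunP => i; rewrite ffunE ord1.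
rewrite walk_sumS; apply: le_trans (IH _); last by move=> j a b jk; apply: h; exact: ltnW.
by apply: walk_sum_le => a b; exact: h.
Qed.

End Walks.

Lemma prod_cyclic (R : comPzRingType) (V : Type) k
    (N : 'I_k.+1 -> V -> V -> R) (v : 'I_k.+1 -> V) :
  \prod_i N i (v i) (v (ordS i)) =
  (\prod_(i < k) N (inord i) (v (inord i)) (v (inord i.+1)))
    * N ord_max (v ord_max) (v ord0).
Proof.
rewrite big_ord_recr/=; congr (_ * _); last first.
  by congr (N _ _ (v _)); apply/val_inj; rewrite /= modnn.
apply: eq_bigr => i _.
have -> : widen_ord (leqnSn k) i = inord i :> 'I_k.+1.
  by apply/val_inj; rewrite /= inordK// ltnW// ltnS.
congr (N _ _ (v _)); apply/val_inj.
by rewrite /= !inordK ?modn_small ?ltnS//; have := ltn_ord i; lia.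
Qed.

(** [J] indexes representations of the elements of [I]; as [G] is nonnegative, an element with
    several representations does no harm. *)
Lemma ler_sum_cover (R : numDomainType) (I J : finType) (P : pred I) (Q : pred J)
    (F : I -> R) (G : J -> R) (phi : J -> I) :
  (forall j, Q j -> 0 <= G j) ->
  (forall i, P i -> exists j, [/\ Q j, phi j = i & F i <= G j]) ->
  \sum_(i | P i) F i <= \sum_(j | Q j) G j.
Proof.
move=> G0 cov; rewrite (partition_big phi xpredT)//= big_mkcond/=.
apply: ler_sum => i _; case: ifP => [/cov[j [Qj ji Fj]]|_].
  rewrite (bigD1 j)/= ?Qj ?ji ?eqxx//; apply: (le_trans Fj); rewrite lerDl.
  by apply: sumr_ge0 => j' /andP[/andP[/G0]].
by apply: sumr_ge0 => j /andP[/G0].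
Qed.

(** * Cycles as closed walks *)

Section Reps.
Variables (m n k : nat).
Notation l := k.+2.
Implicit Types (v : {ffun 'I_l -> 'I_n}) (e : {ffun 'I_l -> edge m n}).

Definition closed_walk v e := [forall i, joins (e i) (v i) (v (ordS i))].

Lemma ordSE (i : 'I_l) : ordS i = i + 1.
Proof. by apply/val_inj; rewrite /= modnDmr addn1. Qed.

Lemma is_cycle_rot (S : {set edge m n}) (s : 'I_l) v e :
  injective e -> closed_walk v e -> S = [set e i | i : 'I_l]%SET ->
  let v' : {ffun 'I_l -> 'I_n} := [ffun i => v (i + s)] in
  let e' : {ffun 'I_l -> edge m n} := [ffun i => e (i + s)] in
  [/\ injective e', closed_walk v' e' & S = [set e' i | i : 'I_l]%SET].
Proof.
move=> ei /forallP cw -> v' e'; split.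
- by move=> i j; rewrite !ffunE => /ei/addIr.
- apply/forallP => i; rewrite !ffunE; have := cw (i + s).
  by rewrite !ordSE addrAC.
- apply/setP => x; apply/imsetP/imsetP => -[i _ ->].
    by exists (i - s) => //; rewrite ffunE subrK.
  by exists (i + s) => //; rewrite ffunE.
Qed.

Lemma is_cycleP (S : {set edge m n}) : is_cycle l S ->
  exists v e, [/\ injective e, closed_walk v e & S = [set e i | i : 'I_l]%SET].
Proof.
case/existsP => v /existsP[e /and4P[_ /injectiveP ei cw /eqP ->]].
by exists v, e.
Qed.

(** A rotation moves the chosen edge to the step that closes the walk. *)
Lemma is_cycle_edge (S : {set edge m n}) x : is_cycle l S -> x \in S ->
  exists v e, [/\ injective e, closed_walk v e, S = [set e i | i : 'I_l]%SET
    & e ord_max = x].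
Proof.
move=> /is_cycleP[v [e [ei cw SE]]]; rewrite {1}SE => /imsetP[i _ ->].
have [ei' cw' SE'] := is_cycle_rot (i - ord_max) ei cw SE.
by exists [ffun j => v (j + (i - ord_max))], [ffun j => e (j + (i - ord_max))];
  split=> //; rewrite ffunE addrC subrK.
Qed.

Definition touches (x : edge m n) (u : 'I_n) := (older_end x == u) || (newer_end x == u).

Lemma is_cycle_vertex (S : {set edge m n}) x u : is_cycle l S -> x \in S -> touches x u ->
  exists v e, [/\ injective e, closed_walk v e, S = [set e i | i : 'I_l]%SET
    & v ord0 = u].
Proof.
move=> /is_cycleP[v [e [ei cw SE]]]; rewrite {1}SE => /imsetP[i _ ->] tu.
have [s su] : exists s, v s = u.
  move: (forallP cw i) tu; rewrite /joins /touches => /orP[] /eqP[-> ->] /orP[] /eqP <-;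
    by [exists i|exists (ordS i)].
have [ei' cw' SE'] := is_cycle_rot s ei cw SE.
by exists [ffun j => v (j + s)], [ffun j => e (j + s)];
  split=> //; rewrite ffunE add0r.
Qed.

Lemma card_is_cycle (S : {set edge m n}) : is_cycle l S -> #|S| = l.
Proof. by move=> /is_cycleP[v [e [ei _ ->]]]; rewrite card_imset// card_ord. Qed.

(** For fixed vertices the edges are chosen separately for each [i], so this is distributivity. *)
Lemma closed_walk_sum (R : comNzRingType) (P : 'I_l -> pred (edge m n))
    (F : 'I_l -> edge m n -> R) v :
  \sum_(e | closed_walk v e && [forall i, P i (e i)]) \prod_i F i (e i) =
  \prod_i \sum_(x | joins x (v i) (v (ordS i)) && P i x) F i x.
Proof.
rewrite bigA_distr_big_dep; apply: eq_bigl => e.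
rewrite unfold_in; apply/andP/forallP => [[/forallP a /forallP b] i|h].
  by rewrite unfold_in a b.
by split; apply/forallP => i; have := h i; rewrite unfold_in => /andP[].
Qed.

End Reps.

(** * Edges between two given vertices *)

Section EdgeSums.
Variables (R : realType) (m n : nat).
Implicit Types (u : 'I_n) (x : edge m n).

Lemma edge_ends_inj x y : older_end x = older_end y -> newer_end x = newer_end y ->
  (tag x).2 = (tag y).2 -> x = y.
Proof.
case: x y => [[[j hj] a] i] [[[j' hj'] a'] i']; rewrite /older_end /newer_end /=.
move=> /(congr1 val)/= o nn aa; move: hj i hj' i' o; rewrite /= in nn *; rewrite nn aa.
move=> hj i hj'; rewrite (bool_irrelevance hj' hj) => i' /val_inj ->//.
Qed.

Lemma older_lt_newer x : (older_end x < newer_end x)%N.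
Proof. exact: (ltn_ord (tagged x)). Qed.

Lemma card_joins u u' : (#|[pred x : edge m n | joins x u u']| <= m)%N.
Proof.
rewrite -[leqRHS]card_ord.
have h x : joins x u u' ->
    nat_of_ord (older_end x) = minn u u' /\ nat_of_ord (newer_end x) = maxn u u'.
  by move=> j; have := older_lt_newer x; case/orP: j => /eqP[<- <-]; lia.
apply: (@leq_card_in _ _ (fun x : edge m n => (tag x).2)) => x y /= /h[a b] /h[a' b'].
apply: edge_ends_inj; apply/val_inj; first exact: (etrans a (esym a')).
exact: (etrans b (esym b')).
Qed.

(** The factor [2] pays for counting vertices from [1] in [kw]: [1 / N <= 2 / (N + 1)] when
    [N >= 1]. *)
Lemma wt_joins_le x u u' : joins x u u' -> wt R x <= 2 * kw R u u'.
Proof.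
move=> j; have lt := older_lt_newer x.
rewrite /kw; have -> : maxn u u' = newer_end x :> nat.
  by move: lt; case/orP: j => /eqP[<- <-]; lia.
have N0 : (0 < newer_end x)%N := leq_ltn_trans (leq0n _) lt.
rewrite /wt; move: N0; case: (nat_of_ord _) => // N _.
rewrite -[leLHS]mul1r ler_pdivrMr ?ltr0n// mulrAC ler_pdivlMr ?ltr0n//.
by rewrite -natrM -[1]/(1%:R) -natrM ler_nat; lia.
Qed.

Lemma sum_joins_wt_le u u' (P : pred (edge m n)) :
  \sum_(x | joins x u u' && P x) wt R x <= (2 * m)%:R * kw R u u'.
Proof.
apply: (@le_trans _ _ (\sum_(x | joins x u u') 2 * kw R u u')).
  rewrite big_mkcond [leRHS]big_mkcond; apply: ler_sum => x _.
  case: (boolP (joins _ _ _)) => //= /wt_joins_le h; case: ifP => // _.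
  by rewrite mulr_ge0 ?kw_ge0.
rewrite sumr_const -[leLHS]mulr_natr mulrAC -natrM ler_wpM2r ?kw_ge0// ler_nat.
by rewrite leq_mul2l card_joins orbT.
Qed.

Lemma sum_joins_1_le u u' (P : pred (edge m n)) :
  \sum_(x | joins x u u' && P x) (1 : R) <= m%:R.
Proof.
rewrite sumr_const ler_nat; apply: leq_trans (card_joins u u').
by apply: subset_leq_card; apply/subsetP => x; rewrite !inE => /andP[].
Qed.

End EdgeSums.

(** * Cycles through a vertex *)

Section CycleSums.
Variables (R : realType) (m n k : nat).
Notation l := k.+2.
Implicit Types (v : {ffun 'I_l -> 'I_n}) (e : {ffun 'I_l -> edge m n}).
(** Two vertices are joined by at most [m] edges, each of weight at most [2 * kw]. *)
Let c : R := (2 * m)%:R.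
Let c_ge0 : 0 <= c. Proof. by rewrite ler0n. Qed.

Lemma sum_cycles_through (u : 'I_n) :
  \sum_(S : {set edge m n} | is_cycle l S && [exists x in S, touches x u])
    \prod_(x in S) wt R x <= c * (4 * c) ^+ k.+1 * u.+1%:R^-1.
Proof.
pose Q (p : {ffun 'I_l -> 'I_n} * {ffun 'I_l -> edge m n}) :=
  (p.1 ord0 == u) && (closed_walk p.1 p.2 && [forall i : 'I_l, true]).
pose G (p : {ffun 'I_l -> 'I_n} * {ffun 'I_l -> edge m n}) :=
  \prod_i wt R (p.2 i).
have wtge (x : edge m n) : 0 <= wt R x := wt_ge0 _ _.
apply: (le_trans (@ler_sum_cover _ _ _ _ Q _ G (fun p => [set p.2 i | i : 'I_l]%SET) _ _)).
- by move=> p _; apply: prodr_ge0.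
- move=> S /andP[cS /existsP[x /andP[xS tx]]].
  have [v [e [ei cw SE v0]]] := is_cycle_vertex cS xS tx.
  exists (v, e); split => //; first by rewrite /Q /= v0 eqxx cw; apply/forallP.
  by rewrite /G /= SE big_imset//= => i j _ _; exact: ei.
rewrite /Q /G -(pair_big_dep (fun v => v ord0 == u)
  (fun v e => closed_walk v e && [forall i : 'I_l, true]) (fun v e => \prod_i wt R (e i)))/=.
pose M (i : nat) (a b : 'I_n) := c * kw R a b.
have M0 i a b : 0 <= M i a b by rewrite mulr_ge0 ?kw_ge0.
(* Each remaining step costs [4 * c] by [kernel_hw]; the closing step is at most
   [c * hw R a * hw R b] by [kw_le_hw]. *)
pose g j (a b : 'I_n) := (a == u)%:R * (c * (4 * c) ^+ (k.+1 - j) * (hw R a * hw R b)).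
apply: (@le_trans _ _ (walk_sum M k.+1 (g k.+1))); last first.
  apply: (le_trans (walk_sum_bound M0 _)) => [j a b jk|].
    rewrite /g /M (eq_bigr (fun x : 'I_n => ((a == u)%:R * (c * (4 * c) ^+ (k.+1 - j.+1))
      * hw R a * c) * (kw R b x * hw R x))); last by move=> x _; ring.
    rewrite -mulr_sumr (_ : (k.+1 - j = (k.+1 - j.+1).+1)%N); last by lia.
    apply: (le_trans (ler_wpM2l _ (kernel_hw R n b))).
      by rewrite !mulr_ge0// ?hw_ge0// exprn_ge0// mulr_ge0.
    by rewrite exprS le_eqVlt; apply/orP; left; apply/eqP; ring.
  rewrite (bigD1 u)//= big1 ?addr0 => [|a /negbTE au]; last by rewrite /g au mul0r.
  by rewrite /g eqxx mul1r subn0 -expr2 hw_sqr.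
rewrite big_mkcond; apply: ler_sum => v _.
case: ifP => vu; last by rewrite /g vu mul0r mulr0.
rewrite (closed_walk_sum (fun _ _ => true) (fun i x => wt R x)).
apply: (@le_trans _ _ (\prod_(i : 'I_l) M i (v i) (v (ordS i)))).
  by apply: ler_prod => i _; rewrite sumr_ge0//= sum_joins_wt_le.
rewrite (prod_cyclic (fun=> M 0)) ler_wpM2l ?prodr_ge0//.
rewrite /g vu mul1r subnn expr0 mulr1 ler_wpM2l//.
by rewrite (mulrC (hw R _)) kw_le_hw.
Qed.

Definition ends (A : {set edge m n}) := [set u | [exists x in A, touches x u]]%SET.

(** * Cycles overlapping a given edge set *)

Section Overlap.
Variable A : {set edge m n}.
Hypothesis endsA : (#|ends A| <= l)%N.

Let iV (u : 'I_n) : R := (u \in ends A)%:R.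
Let H : R := \sum_(u in ends A) hw R u.
Let L : R := l%:R.
Let B : R := c * (4 + L ^+ 2).

(** [b] tells whether the step uses an edge of [A]; such an edge is already paid for and has weight
    [1]. *)
Let N (b : bool) (u u' : 'I_n) : R :=
  \sum_(x | joins x u u' && ((x \in A) == b)) (if b then 1 else wt R x).

Let iV_ge0 u : 0 <= iV u. Proof. exact: ler0n. Qed.
Let H_ge0 : 0 <= H. Proof. by apply: sumr_ge0 => u _; exact: hw_ge0. Qed.
Let N_ge0 b u u' : 0 <= N b u u'.
Proof. by apply: sumr_ge0 => x _; case: b => //; exact: wt_ge0. Qed.
Let L_ge0 : 0 <= L. Proof. exact: ler0n. Qed.
Let B_ge0 : 0 <= B. Proof. by rewrite mulr_ge0// addr_ge0// exprn_ge0. Qed.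
Let L_ge2 : 2 <= L. Proof. by rewrite /L ler_nat. Qed.
Let H_le : H <= L.
Proof.
apply: (@le_trans _ _ (\sum_(u in ends A) 1)).
  by apply: ler_sum => u _; exact: hw_le1.
by rewrite sumr_const ler_nat.
Qed.
Let card_le : (#|ends A|%:R : R) <= L. Proof. by rewrite ler_nat. Qed.

Let sum_iV (phi : 'I_n -> R) : \sum_u iV u * phi u = \sum_(u in ends A) phi u.
Proof.
rewrite [RHS]big_mkcond; apply: eq_bigr => u _; rewrite /iV.
by case: ifP; rewrite ?mul1r ?mul0r.
Qed.

Let N_true u u' : N true u u' <= m%:R * (iV u * iV u').
Proof.
have [e|ne] := eqVneq (iV u * iV u') 1.
  by rewrite e mulr1; exact: sum_joins_1_le.
rewrite /N big1 ?mulr_ge0// => x /andP[j /eqP xA].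
have [ua ub] : u \in ends A /\ u' \in ends A.
  by rewrite !inE; split; apply/existsP; exists x; rewrite xA /touches;
    case/orP: j => /eqP[-> ->]; rewrite eqxx ?orbT.
by move: ne; rewrite /iV ua ub mulr1 eqxx.
Qed.

Let N_false u u' : N false u u' <= c * kw R u u'.
Proof. exact: sum_joins_wt_le. Qed.

(* [s] tells whether the remaining part of the walk uses an edge outside [A]. *)
Let psi (s : bool) (b : 'I_n) : R :=
  if s then H * hw R b + H ^+ 2 * iV b else iV b.

Let psi_ge0 s b : 0 <= psi s b.
Proof.
by case: s; rewrite /psi ?iV_ge0// addr_ge0 ?mulr_ge0 ?hw_ge0 ?exprn_ge0.
Qed.

(** For [t] true the next vertex lies in [ends A], where [psi] sums to at most [1 + L] times
    [H ^+ 2] or [1]. For [t] false, [kernel_hw] gives the [4] in [B], while the [iV] part of [psi]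
    yields [H ^+ 3 * hw R b], and [H <= L] gives the [L ^+ 2]. *)
Let step s t b : \sum_x N t b x * psi s x <= B * psi (s || ~~ t) b.
Proof.
have Hh : \sum_(u in ends A) hw R u = H by [].
have L2 := L_ge2; have iVb := iV_ge0 b; have hb := hw_ge0 R b.
have m0 : 0 <= m%:R :> R by rewrite ler0n.
have cE : c = 2 * m%:R by rewrite /c natrM.
have LL : 2 * L <= L ^+ 2 by rewrite expr2 ler_wpM2r// (le_trans _ L2).
case: t; rewrite ?orbF ?orbT.
  apply: (@le_trans _ _ (m%:R * iV b * \sum_(x in ends A) psi s x)).
    rewrite -sum_iV mulr_sumr; apply: ler_sum => x _.
    by rewrite mulrA ler_wpM2r// -mulrA N_true.
  have E : \sum_(x in ends A) psi s x <= (1 + L) * (if s then H ^+ 2 else 1).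
    rewrite /psi; case: (s).
      rewrite big_split/= -!mulr_sumr Hh mulrDl mul1r -expr2 lerD// mulrC ler_wpM2r ?exprn_ge0//.
      apply: le_trans card_le; rewrite -sum1_card natr_sum; apply: ler_sum => x _.
      by rewrite /iV; case: (_ \in _).
    apply: (@le_trans _ _ #|ends A|%:R).
      rewrite -sum1_card natr_sum; apply: ler_sum => x _.
      by rewrite /iV; case: (_ \in _).
    by rewrite mulr1 (le_trans card_le)// lerDr.
  apply: (le_trans (ler_wpM2l _ E)); first by rewrite mulr_ge0.
  have E2 : m%:R * (1 + L) <= B.
    by rewrite /B cE -mulrA mulrCA ler_wpM2l//; lra.
  case: (s) => /=.
    rewrite mulrACA (mulrC (iV b)); apply: ler_pM => //.
    - by rewrite mulr_ge0// addr_ge0// (le_trans _ L2).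
    - by rewrite mulr_ge0// exprn_ge0.
    - by rewrite lerDr mulr_ge0.
  by rewrite mulr1 mulrAC; apply: ler_wpM2r.
apply: (@le_trans _ _ (c * \sum_(x < n) kw R b x * psi s x)).
  rewrite mulr_sumr; apply: ler_sum => x _.
  by rewrite mulrA ler_wpM2r// N_false.
have kiV : \sum_(x < n) kw R b x * iV x <= hw R b * H.
  under eq_bigr do rewrite mulrC; rewrite sum_iV -Hh mulr_sumr.
  by apply: ler_sum => x _; exact: kw_le_hw.
rewrite /B -mulrA ler_wpM2l//.
apply: (@le_trans _ _ ((4 + L ^+ 2) * (H * hw R b))); last first.
  by rewrite ler_wpM2l ?addr_ge0 ?exprn_ge0 ?(le_trans _ L2)// lerDl mulr_ge0 ?exprn_ge0.
have Hhb : 0 <= H * hw R b by rewrite mulr_ge0.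
case: (s); rewrite /psi; last first.
  rewrite (le_trans kiV)// mulrC -[leLHS]mul1r ler_wpM2r//.
  by have := exprn_ge0 2 L_ge0; lra.
under eq_bigr do rewrite mulrDr mulrCA (mulrCA (kw R b _)).
rewrite big_split/= -!mulr_sumr mulrDl lerD//.
  by rewrite mulrCA ler_wpM2l// kernel_hw.
apply: (@le_trans _ _ (H ^+ 2 * (hw R b * H))).
  by rewrite ler_wpM2l ?exprn_ge0.
rewrite (mulrC (hw R b)) ler_wpM2r// ler_sqr ?nnegrE//.
Qed.

(** Expanding the square and using [2 * x * y <= x ^+ 2 + y ^+ 2] turns [H ^+ 2] back into inverse
    vertex numbers. *)
Let H_sqr_le : H ^+ 2 <= L * \sum_(u in ends A) u.+1%:R^-1.
Proof.
rewrite expr2 big_distrlr/=.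
apply: (@le_trans _ _ (\sum_(u in ends A) \sum_(u' in ends A)
   ((u.+1%:R^-1 + u'.+1%:R^-1) / 2))).
  apply: ler_sum => u _; apply: ler_sum => u' _; rewrite -(hw_sqr R u) -(hw_sqr R u').
  by have := sqr_ge0 (hw R u - hw R u'); rewrite sqrrB; lra.
apply: (@le_trans _ _ (#|ends A|%:R * \sum_(u in ends A) u.+1%:R^-1)); last first.
  by rewrite ler_wpM2r// sumr_ge0.
under eq_bigr do rewrite -mulr_suml big_split/= sumr_const.
rewrite -mulr_suml big_split/= sumr_const sumrMnl -mulr_natl.
by rewrite le_eqVlt; apply/orP; left; apply/eqP; field.
Qed.

(** [t] is the pattern of the edges in [A]. The closing step lies in [A], so the walk starts on
    [ends A]. Some step leaves [A], so the initial value is [psi true], whose sum over [ends A] is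
    at most [(1 + L) * H ^+ 2]. *)
Let sum_walks_overlap (t : {ffun 'I_l -> bool}) :
  t ord_max -> (exists i, ~~ t i) ->
  \sum_(v : {ffun 'I_l -> 'I_n}) \prod_i N (t i) (v i) (v (ordS i))
    <= m%:R * B ^+ k.+1 * (1 + L) * L * \sum_(u in ends A) u.+1%:R^-1.
Proof.
move=> tmax [i0 ti0].
(* This is the first argument of [psi] at time [j]: whether some step from [j] on uses an edge
   outside [A]. *)
pose seen j := [exists i : 'I_l, (j <= i)%N && ~~ t i].
have seen0 : seen 0 by apply/existsP; exists i0.
have seenk : seen k.+1 = false.
  apply/existsP => -[i /andP[ki]]; suff -> : i = ord_max by rewrite tmax.
  by apply/val_inj/eqP; rewrite /= eqn_leq ki andbT -ltnS ltn_ord.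
have seenS j : (j < k.+1)%N -> seen j.+1 || ~~ t (inord j) = seen j.
  move=> jk; apply/orP/existsP => [[/existsP[i /andP[ji ti]]|tj]|[i /andP[ji ti]]].
  - by exists i; rewrite ltnW.
  - by exists (inord j); rewrite tj inordK ?leqnn// ltnW.
  - move: ji; rewrite leq_eqVlt => /orP[/eqP ji|ji]; last first.
      by left; apply/existsP; exists i; rewrite ji.
    by right; suff -> : inord j = i by []; apply/val_inj; rewrite /= inordK// ltnW.
have L2 := L_ge2; have L0 : 0 <= L := L_ge0.
have B0 := B_ge0.
pose g j (a b : 'I_n) := m%:R * B ^+ (k.+1 - j) * (iV a * psi (seen j) b).
under eq_bigr do rewrite (prod_cyclic (fun i : 'I_l => N (t i))).
pose M j := N (t (inord j)).
have M0 i a b : 0 <= M i a b := N_ge0 _ _ _.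
apply: (@le_trans _ _ (walk_sum M k.+1 (g k.+1))).
  apply: ler_sum => v _; rewrite ler_wpM2l ?prodr_ge0//.
  rewrite tmax /g seenk subnn expr0 mulr1 (mulrC (iV _)); exact: N_true.
apply: (le_trans (walk_sum_bound M0 _)) => [j a b jk|].
  pose K := m%:R * B ^+ (k.+1 - j.+1) * iV a.
  rewrite (eq_bigr (fun x => K * (M j b x * psi (seen j.+1) x))); last first.
    by move=> x _; rewrite /g /K mulrCA -!mulrA (mulrCA (iV a)).
  have K0 : 0 <= K by rewrite mulr_ge0// mulr_ge0// exprn_ge0.
  rewrite -mulr_sumr; apply: (le_trans (ler_wpM2l K0 (step _ _ _))).
  rewrite (seenS j jk) /g /K; have -> : (k.+1 - j = (k.+1 - j.+1).+1)%N by rewrite -subSn// subSS.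
  by rewrite exprSr mulrACA !mulrA.
rewrite /g seen0 subn0 -mulr_sumr sum_iV -!mulrA ler_wpM2l// ler_wpM2l ?exprn_ge0//.
apply: (@le_trans _ _ ((1 + L) * H ^+ 2)); last first.
  by rewrite ler_wpM2l// addr_ge0.
rewrite /psi big_split/= -!mulr_sumr -/H -expr2 mulrDl mul1r lerD// mulrC ler_wpM2r ?exprn_ge0//.
apply: le_trans card_le; rewrite -sum1_card natr_sum; apply: ler_sum => x _.
by rewrite /iV; case: (_ \in _).
Qed.

(** Cycles are sorted by their pattern of edges in [A], whence the [2 ^ l], after a rotation that
    puts an edge of [A] last. *)
Lemma sum_cycles_overlap :
  \sum_(S : {set edge m n} |
      is_cycle l S && ([exists x in S, x \in A] && ~~ (S \subset A)))
    \prod_(x in S :\: A) wt R x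
  <= (2 ^ l)%:R * (m%:R * B ^+ k.+1 * (1 + L) * L * \sum_(u in ends A) u.+1%:R^-1).
Proof.
pose J := ({ffun 'I_l -> bool} * ({ffun 'I_l -> 'I_n} * {ffun 'I_l -> edge m n}))%type.
pose F (t : {ffun 'I_l -> bool}) (i : 'I_l) (x : edge m n) : R := if t i then 1 else wt R x.
pose Q (p : J) := (p.1 ord_max && [exists i, ~~ p.1 i]) &&
  (closed_walk p.2.1 p.2.2 && [forall i, (p.2.2 i \in A) == p.1 i]).
pose G (p : J) := \prod_i F p.1 i (p.2.2 i).
have wtge (x : edge m n) : 0 <= wt R x := wt_ge0 _ _.
apply: (le_trans (@ler_sum_cover _ _ _ _ Q _ G (fun p => [set p.2.2 i | i : 'I_l]%SET) _ _)).
- by move=> p _; apply: prodr_ge0 => i _; rewrite /F; case: ifP.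
- move=> S /and3P[cS /existsP[x /andP[xS xA]] /subsetPn[y yS yA]].
  have [v [e [ei cw SE ex]]] := is_cycle_edge cS xS.
  exists ([ffun i => e i \in A], (v, e)); split => //.
    rewrite /Q /= ffunE ex xA cw /=; apply/andP; split.
      move: yS; rewrite SE => /imsetP[i _ yi]; apply/existsP; exists i.
      by rewrite ffunE -yi.
    by apply/forallP => i; rewrite ffunE.
  rewrite /G /= (_ : \prod_(x in S :\: A) _ = \prod_(x in S) (if x \in A then 1 else wt R x)).
    rewrite SE big_imset//=; last by move=> i j _ _; exact: ei.
    by apply: ler_prod => i _; rewrite /F ffunE lexx andbT; case: ifP.
  rewrite big_mkcond [RHS]big_mkcond; apply: eq_bigr => z _; rewrite !inE.
  by case: (z \in A); case: (z \in S).
rewrite /Q /G -(pair_big_dep (fun t : {ffun 'I_l -> bool} => t ord_max && [exists i, ~~ t i])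
  (fun t p => closed_walk p.1 p.2 && [forall i, (p.2 i \in A) == t i])
  (fun t p => \prod_i F t i (p.2 i)))/=.
apply: (@le_trans _ _ (\sum_(t : {ffun 'I_l -> bool})
   (m%:R * B ^+ k.+1 * (1 + L) * L * \sum_(u in ends A) u.+1%:R^-1))); last first.
  by rewrite sumr_const card_ffun card_bool card_ord [leRHS]mulr_natl.
rewrite big_mkcond; apply: ler_sum => t _; case: ifP => [/andP[tm /existsP ti]|_].
  apply: le_trans (sum_walks_overlap tm ti).
  rewrite -(pair_big_dep xpredT (fun v e => closed_walk v e && [forall i, (e i \in A) == t i])
     (fun v e => \prod_i F t i (e i)))/=.
  by apply: ler_sum => v _; rewrite (closed_walk_sum (fun i x => (x \in A) == t i) (F t)).
apply: mulr_ge0; last exact: sumr_ge0.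
have L1 : 0 <= 1 + L by apply: addr_ge0; [exact: ler01|exact: L_ge0].
have BB : 0 <= B ^+ k.+1 by apply: exprn_ge0; exact: B_ge0.
exact: (mulr_ge0 (mulr_ge0 (mulr_ge0 (ler0n R m) BB) L1) L_ge0).
Qed.

End Overlap.

Lemma card_ends (S : {set edge m n}) : is_cycle l S -> (#|ends S| <= l)%N.
Proof.
move=> /is_cycleP[v [e [ei cw SE]]].
have sub : ends S \subset [set v i | i : 'I_l]%SET.
  apply/subsetP => u; rewrite inE => /existsP[x /andP[]].
  rewrite {1}SE => /imsetP[i _ ->]; move: (forallP cw i).
  by rewrite /joins /touches => /orP[] /eqP[-> ->] /orP[] /eqP <-; apply: imset_f.
by apply: (leq_trans (subset_leq_card sub)); rewrite -[leqRHS]card_ord leq_imset_card.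
Qed.

End CycleSums.

(** * Expected numbers of cycles and of overlapping pairs *)

Section Harmonic.
Variable R : realType.

Lemma ln_succ_le j : (0 < j)%N -> ln (j.+1%:R : R) - ln j%:R <= j%:R^-1.
Proof.
move=> j0; have jR : (0 : R) < j%:R by rewrite ltr0n.
rewrite -ln_div ?posrE// -natr1 mulrDl divff ?gt_eqF// mul1r.
by rewrite le_ln1Dx// (@lt_le_trans _ _ 0)// ?invr_ge0 ?ltW// oppr_lt0.
Qed.

Lemma ln_succ_ge j : (0 < j)%N -> j.+1%:R^-1 <= ln (j.+1%:R : R) - ln j%:R.
Proof.
move=> j0; have jR : (0 : R) < j%:R by rewrite ltr0n.
have JR : (0 : R) < j.+1%:R by rewrite ltr0n.
rewrite -opprB -ln_div ?posrE// lerNr.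
have -> : j%:R / j.+1%:R = 1 + (- j.+1%:R^-1) :> R.
  by rewrite -[in LHS](addrK 1 j%:R) natr1 mulrBl divff ?gt_eqF// mul1r.
rewrite le_ln1Dx// ltrNr opprK invf_lt1//.
by rewrite ltr1n.
Qed.

Lemma harmonic_le n : \sum_(i < n) (i.+1%:R^-1 : R) <= 1 + ln n%:R.
Proof.
case: n => [|n]; first by rewrite big_ord0 ln0// addr0.
elim: n => [|n IH]; first by rewrite big_ord1 invr1 ln1 addr0.
rewrite big_ord_recr/=; apply: le_trans (lerD IH (lexx _)) _.
by rewrite -addrA lerD2l -lerBrDl; exact: ln_succ_ge.
Qed.

Lemma harmonic_ge j0 n : (0 < j0)%N ->
  ln (n%:R : R) - ln j0%:R <= \sum_(i < n | (j0 <= i)%N) (i%:R^-1 : R).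
Proof.
move=> j00; elim: n => [|n IH].
  rewrite big_ord0 ln0// sub0r oppr_le0 ln_ge0//.
  by rewrite ler1n.
rewrite big_mkcond big_ord_recr -big_mkcond/=.
case: (leqP j0 n) => jn.
  apply: le_trans (lerD IH (lexx _)); rewrite addrAC lerD2r -lerBlDl.
  by apply: ln_succ_le; exact: leq_trans jn.
rewrite addr0; apply: (@le_trans _ _ 0); last by apply: sumr_ge0.
by rewrite subr_le0 ler_ln ?posrE ?ltr0n// ler_nat.
Qed.

End Harmonic.

(** * Cycles with distinct half-edges on a prescribed vertex set *)

Section LowerBound.
Variables (m n k : nat).
Notation l := k.+2.

Lemma mk_edge (u u' : 'I_n) (a : 'I_m) : (u < u')%N ->
  exists x : edge m n, [/\ older_end x = u, newer_end x = u' & (tag x).2 = a].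
Proof.
move=> uu'; have u'0 : (0 < u')%N := leq_ltn_trans (leq0n _) uu'.
pose p : half_edge m n := (exist _ u' u'0, a).
exists (Tagged (fun p : half_edge m n => 'I_(val p.1)) (Ordinal uu' : 'I_(val p.1))).
by split=> //; apply/val_inj.
Qed.

(* An edge is labelled by which of its two ends, in cyclic order, is newer:  *)
(* then no half-edge is used twice, whatever the order of the vertices.      *)
Lemma cycle_on (hm : (2 <= m)%N) (A : {set 'I_n}) : #|A| = l ->
  exists S : {set edge m n}, [/\ is_cycle l S, ends S = A &
    {in S &, injective (@tag _ _ : edge m n -> half_edge m n)}].
Proof.
move=> cA.
pose v (i : 'I_l) : 'I_n := enum_val (cast_ord (esym cA) i).
have vi : injective v by move=> i j /enum_val_inj /cast_ord_inj.
have vA i : v i \in A by exact: enum_valP.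
have ordSi (i : 'I_l) : ordS i != i.
  by rewrite ordSE -subr_eq0 addrC addKr oner_eq0.
have ordS_inj : injective (@ordS l) by move=> i j; rewrite !ordSE => /addIr.
have [m0 m1] : (0 < m)%N /\ (1 < m)%N by split => //; exact: ltnW.
have ex i : exists x : edge m n, joins x (v i) (v (ordS i)) /\
    (tag x).2 = (if newer_end x == v i then Ordinal m0 else Ordinal m1).
  have ne : (v (ordS i) == v i) = false by rewrite (inj_eq vi) (negbTE (ordSi i)).
  case: (ltngtP (v i) (v (ordS i))) => [lt|gt|/val_inj eq].
  - have [x [ox nx lx]] := mk_edge (Ordinal m1) lt.
    by exists x; rewrite /joins ox nx !eqxx ne.
  - have [x [ox nx lx]] := mk_edge (Ordinal m0) gt.
    by exists x; rewrite /joins ox nx !eqxx orbT.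
  - by rewrite -eq eqxx in ne.
have [e he] := fin_all_exists ex.
(* Equal half-edges have the same newer end and the same label. The label tells whether that end is
   [v i] or [v (ordS i)], and either one determines [i]. *)
have tagi i j : tag (e i) = tag (e j) -> i = j.
  move=> t; have [ji li] := he i; have [jj lj] := he j.
  have nn : newer_end (e i) = newer_end (e j) by rewrite /newer_end t.
  move: li lj; rewrite t => -> .
  case: ifP => [/eqP a|a]; case: ifP => [/eqP b|b] // _.
    by apply: vi; rewrite -a -b nn.
  have aux i' : joins (e i') (v i') (v (ordS i')) -> (newer_end (e i') == v i') = false ->
      newer_end (e i') = v (ordS i').
    by move=> /orP[] /eqP[_ ->] => // /eqP.
  by apply/ordS_inj/vi; rewrite -(aux _ ji a) -(aux _ jj b).
have ei : injective e by move=> i j ij; apply: tagi; rewrite ij.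
exists [set e i | i : 'I_l]%SET; split.
- apply/existsP; exists [ffun i => v i]; apply/existsP; exists [ffun i => e i].
  apply/and4P; split.
  + by apply/injectiveP => i j; rewrite !ffunE => /vi.
  + by apply/injectiveP => i j; rewrite !ffunE => /ei.
  + by apply/forallP => i; rewrite !ffunE; have [] := he i.
  + by apply/eqP; apply: eq_imset => i; rewrite ffunE.
- apply/setP => u; rewrite inE; apply/existsP/idP => [[x /andP[/imsetP[i _ ->]]]|uA].
    have [+ _] := he i; rewrite /joins /touches.
    by move=> /orP[] /eqP[-> ->] /orP[] /eqP <-.
  pose i := cast_ord cA (enum_rank_in uA u).
  have ui : v i = u by rewrite /v /i cast_ordK enum_rankK_in.
  exists (e i); rewrite imset_f//=; have [+ _] := he i; rewrite /joins /touches.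
  by rewrite ui => /orP[] /eqP[-> ->]; rewrite eqxx ?orbT.
- by move=> x y /imsetP[i _ ->] /imsetP[j _ ->] /tagi ->.
Qed.

End LowerBound.

(** Each of the [q] factors of the falling factorial is at least [j - k]. *)
Lemma expn_le_ffact k q j : (q <= k.+1)%N -> ((j - k) ^ q <= j ^_ q)%N.
Proof.
elim: q => [//|q IH] qk; rewrite ffactnSr expnSr leq_mul ?IH//; first exact: ltnW.
by apply: leq_sub2l.
Qed.

(** * Bounds on the mean and on the local error *)

Section Moments.
Variables (R : realType) (m k : nat).
Notation l := k.+2.
(** [D1] and [D2] are the constants of [sum_cycles_through] and [sum_cycles_overlap]. *)
Let D1 : R := (2 * m)%:R * (4 * (2 * m)%:R) ^+ k.+1.
Let D2 : R := (2 ^ l)%:R *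
  (m%:R * ((2 * m)%:R * (4 + l%:R ^+ 2)) ^+ k.+1 * (1 + l%:R) * l%:R).

Let D1_ge0 : 0 <= D1. Proof. by rewrite mulr_ge0// exprn_ge0// mulr_ge0. Qed.
Let D2_ge0 : 0 <= D2.
Proof.
have b0 : 0 <= (2 * m)%:R * (4 + l%:R ^+ 2) :> R.
  by rewrite mulr_ge0// addr_ge0// exprn_ge0.
have c0 : 0 <= 1 + l%:R :> R by rewrite addr_ge0.
by apply: mulr_ge0 => //; rewrite !mulr_ge0 ?(exprn_ge0 _ b0).
Qed.

Section FixedSize.
Variable n : nat.
Implicit Types (S T : {set edge m n}).

Let through u :
  \sum_(S : {set edge m n} | is_cycle l S && (u \in ends S)) pr R S <= D1 * u.+1%:R^-1.
Proof.
apply: le_trans (sum_cycles_through R _ _ u).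
rewrite (eq_bigl (fun S => is_cycle l S && [exists x in S, touches x u])); last first.
  by move=> S; rewrite inE.
by apply: ler_sum => S _; exact: pr_le.
Qed.

Let through_any (E : {set 'I_n}) (P : pred {set edge m n}) :
  (forall S, P S -> is_cycle l S /\ exists2 u, u \in E & u \in ends S) ->
  \sum_(S | P S) pr R S <= D1 * \sum_(u in E) u.+1%:R^-1.
Proof.
move=> h; rewrite mulr_sumr.
apply: (@le_trans _ _ (\sum_(u in E)
    \sum_(S : {set edge m n} | is_cycle l S && (u \in ends S)) pr R S)); last first.
  by apply: ler_sum => u _; exact: through.
rewrite pair_big_dep/=; apply: (ler_sum_cover (phi := snd)) => [p _|S /h[cS [u uE uS]]].
  exact: pr_ge0.
by exists (u, S); rewrite /= uE cS uS.
Qed.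

Lemma mean_cycles_le : mean_cycles R m l n <= D1 * (1 + ln n%:R).
Proof.
rewrite mean_cyclesE.
apply: (@le_trans _ _ (D1 * \sum_(u in [set: 'I_n]) u.+1%:R^-1)).
  apply: through_any => S cS; split => //.
  have [v [e [ei cw SE]]] := is_cycleP cS.
  exists (newer_end (e ord0)); first by rewrite inE.
  rewrite inE; apply/existsP; exists (e ord0).
  by rewrite SE imset_f//= /touches eqxx orbT.
rewrite ler_wpM2l//; apply: le_trans (harmonic_le R n).
by rewrite big_mkcond; apply: ler_sum => i _; rewrite inE.
Qed.

Lemma local_error_le : local_error R m n l <= (D1 + D2) * (D1 * 2).
Proof.
pose Y S : R := \sum_(u in ends S) u.+1%:R^-1.
apply: (@le_trans _ _ (\sum_(S : {set edge m n} | is_cycle l S) pr R S * ((D1 + D2) * Y S))).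
  apply: ler_sum => S cS; rewrite mulrDl mulrDr lerD//.
    (* A shared half-edge gives both cycles the same newer end, so [T] passes through [ends S]. *)
    rewrite -mulr_sumr ler_wpM2l ?pr_ge0//; apply: through_any => T.
    move=> /andP[cT /existsP[x /andP[xS /imsetP[y yT xy]]]]; split=> //.
    exists (newer_end x); rewrite inE; apply/existsP.
      by exists x; rewrite xS /touches eqxx orbT.
    by exists y; rewrite yT /touches /newer_end xy eqxx orbT.
  apply: (@le_trans _ _ (pr R S * \sum_(T : {set edge m n} | is_cycle l T &&
      ([exists x in T, x \in S] && ~~ (T \subset S))) \prod_(x in T :\: S) wt R x)); last first.
    rewrite ler_wpM2l ?pr_ge0//; apply: le_trans (sum_cycles_overlap R (card_ends cS)) _.
    by rewrite /D2 /Y !mulrA.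
  rewrite mulr_sumr big_mkcond [leRHS]big_mkcond; apply: ler_sum => T _.
  have wtge (x : edge m n) : 0 <= wt R x := wt_ge0 _ _.
  have rhs0 : 0 <= pr R S * \prod_(x in T :\: S) wt R x.
    by rewrite mulr_ge0 ?pr_ge0// prodr_ge0.
  case: (boolP (is_cycle l T)) => //= cT.
  have mE : mean (fun w => ((S \subset graph w) && (T \subset graph w))%:R) = pr R (S :|: T).
    by apply: eq_mean => w; rewrite subUset.
  case: (boolP (linked S T && _)) => [/andP[lk TS]|_]; last by case: ifP.
  (* If [T] shares a half-edge with [S] but no edge, the union has probability [0] by [pr_conflict];
     and [T \subset S] would force [T = S], both having [l] edges. *)
  rewrite mE; case: (boolP ([exists x in T, x \in S] && _)) => [_|].
    exact: prU_le.
  rewrite negb_and => /orP[|/negPn sub].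
    rewrite negb_exists => /forallP dis.
    case/existsP: lk => x /andP[xS /imsetP[y yT xy]].
    rewrite (@pr_conflict R _ _ _ x y) ?inE ?xS ?yT ?orbT//.
    by have := dis y; rewrite yT /=; apply: contraNneq => <-.
  suff E : T == S by rewrite E in TS.
  by rewrite eqEcard sub (card_is_cycle cS) (card_is_cycle cT) leqnn.
under eq_bigr do rewrite mulrCA; rewrite -mulr_sumr ler_wpM2l ?addr_ge0//.
rewrite /Y; under eq_bigr do rewrite mulr_sumr.
(* After the exchange, [u] carries [1 / u.+1] times the weight of the cycles through it, itself at
   most [D1 / u.+1]; inverse squares remain. *)
rewrite (exchange_big_dep xpredT)//=.
apply: (@le_trans _ _ (\sum_(u < n) D1 * (u.+1%:R ^- 2))).
  apply: ler_sum => u _; rewrite -mulr_suml.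
  apply: (le_trans (ler_wpM2r _ (through u))); first by rewrite invr_ge0.
  by rewrite -mulrA -invfM -expr2.
by rewrite -mulr_sumr ler_wpM2l// sum_inv_sqr.
Qed.

(** There are ['C(j, k.+1)] vertex sets of size [l] with maximum [j], and [cycle_on] gives each a
    cycle of probability at least [j ^- l]; [ends] recovers the set, so these cycles differ. As
    [j <= 2 * (j - k)], the binomial is at least [(j / 2) ^ k.+1] over the factorial of [k.+1]. *)
Lemma through_ge (hm : (2 <= m)%N) (j : 'I_n) : (k.+1.*2 <= j)%N ->
  ((2 ^ k.+1 * k.+1`!)%:R)^-1 * j%:R^-1 <=
  \sum_(S : {set edge m n} | is_cycle l S && (j \in ends S)) pr R S.
Proof.
move=> kj; have j0 : (0 < j)%N by apply: leq_trans kj; rewrite double_gt0.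
have jR : (0 : R) < j%:R by rewrite ltr0n.
pose As := [set A : {set 'I_n} | [&& #|A| == l, j \in A & [forall u in A, (u <= j)%N]]]%SET.
apply: (@le_trans _ _ (\sum_(A in As) j%:R ^- l)); last first.
  apply: (ler_sum_cover (phi := @ends m n)) => [S _|A]; first exact: pr_ge0.
  rewrite inE => /and3P[/eqP cA jA /forallP Aj].
  have [S [cS eS tS]] := cycle_on hm cA; exists S; rewrite cS eS; split=> //.
  rewrite pr_inj// -(card_is_cycle cS) -exprVn -prodr_const.
  apply: ler_prod => x xS; rewrite invr_ge0 (ltW jR)/= lef_pV2 ?posrE//.
    rewrite ler_nat; have := Aj (newer_end x); rewrite -eS inE => /implyP; apply.
    by apply/existsP; exists x; rewrite xS /touches eqxx orbT.
  by rewrite ltr0n (leq_ltn_trans _ (older_lt_newer x)).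
have cAs : ('C(j, k.+1) <= #|As|)%N.
  pose Bs := [set B : {set 'I_n} | B \subset [set u : 'I_n | (u < j)%N] & #|B| == k.+1]%SET.
  have <- : #|Bs| = 'C(j, k.+1).
    rewrite cards_draws; congr 'C(_, _).
    rewrite cardsE -sum1_card.
    rewrite -(big_ord_widen_cond n xpredT (fun=> 1%N)) ?sum1_card ?card_ord//; exact: ltnW.
  have jB B : B \in Bs -> j \notin B.
    by rewrite inE => /andP[/subsetP sub _]; apply/negP => /sub; rewrite inE ltnn.
  rewrite -(@card_in_imset _ _ (fun B : {set 'I_n} => j |: B)%SET); last first.
    by move=> B B' /jB h /jB h' /(congr1 (fun X => X :\ j)%SET); rewrite !setU1K.
  apply/subset_leq_card/subsetP => _ /imsetP[B BB ->].
  rewrite inE cardsU1 (jB _ BB) setU11 /=; move: BB; rewrite inE => /andP[/subsetP sub /eqP ->].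
  rewrite eqxx /=; apply/forallP => u; apply/implyP; rewrite !inE => /orP[/eqP ->//|/sub].
  by rewrite inE => /ltnW.
rewrite sumr_const -[leRHS]mulr_natr mulrC.
apply: (@le_trans _ _ (j%:R ^- l * 'C(j, k.+1)%:R)); last first.
  by rewrite ler_wpM2l ?invr_ge0 ?exprn_ge0 ?ler_nat// ltW.
have jC : (j ^ k.+1 <= 2 ^ k.+1 * k.+1`! * 'C(j, k.+1))%N.
  rewrite -mulnA (mulnC k.+1`!) bin_ffact.
  apply: leq_trans (leq_mul (leqnn _) (expn_le_ffact j (leqnn _))).
  rewrite -expnMn leq_exp2r//; move: kj; rewrite -addnn; lia.
rewrite [leRHS]mulrC ler_pdivlMr ?exprn_gt0// exprS -mulrA mulrCA mulKf ?gt_eqF//.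
rewrite ler_pdivrMl; first by rewrite -natrX -natrM ler_nat.
by rewrite ltr0n muln_gt0 expn_gt0 fact_gt0.
Qed.

(** Summing [through_ge] over [j] counts each cycle once per vertex, that is, at most [l] times. *)
Lemma mean_cycles_ge (hm : (2 <= m)%N) :
  ((2 ^ k.+1 * k.+1`!)%:R)^-1 * (ln n%:R - ln (k.+1.*2)%:R) <= l%:R * mean_cycles R m l n.
Proof.
rewrite mean_cyclesE.
apply: (@le_trans _ _ (\sum_(j < n)
    \sum_(S : {set edge m n} | is_cycle l S && (j \in ends S)) pr R S)).
  apply: (@le_trans _ _ (\sum_(j < n | (k.+1.*2 <= j)%N)
      ((2 ^ k.+1 * k.+1`!)%:R)^-1 * j%:R^-1)).
    by rewrite -mulr_sumr ler_wpM2l ?invr_ge0// harmonic_ge// double_gt0.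
  rewrite big_mkcond; apply: ler_sum => j _; case: ifP => [/(through_ge hm)//|_].
  by apply: sumr_ge0 => S _; exact: pr_ge0.
rewrite (exchange_big_dep (fun S => is_cycle l S))/=; last by move=> j S _ /andP[].
rewrite mulr_sumr; apply: ler_sum => S cS.
rewrite sumr_const -[leLHS]mulr_natl ler_wpM2r ?pr_ge0// ler_nat.
apply: leq_trans (card_ends cS); apply: subset_leq_card.
by apply/subsetP => u; rewrite unfold_in => /andP[].
Qed.

End FixedSize.

Lemma local_error_bounded : exists2 C : R, 0 <= C & forall n, local_error R m n l <= C.
Proof.
exists ((D1 + D2) * (D1 * 2)); last exact: local_error_le.
by rewrite mulr_ge0 ?mulr_ge0 ?addr_ge0.
Qed.

End Moments.

(** * Logarithmic growth and the total variation bound *)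

Local Open Scope classical_set_scope.

Theorem theorem3p1 (R : realType) (m l : nat)
    (hm : (2 <= m)%N) (hl : (2 <= l)%N) :
  (exists c C' : R, 0 < c /\ c <= C' /\
     \forall n \near \oo,
       c * ln n%:R <= mean_cycles R m l n <= C' * ln n%:R) /\
  (exists C : R, 0 < C /\
     \forall n \near \oo,
       (dTV (law_cycles R m l n) (Po (mean_cycles R m l n))
          <= (C * (ln n%:R)^-1)%:E)%E).
Proof.
case: l hl => [//|[//|k]] _; set l := k.+2.
set D1 : R := (2 * m)%:R * (4 * (2 * m)%:R) ^+ k.+1.
have D10 : 0 <= D1 by rewrite mulr_ge0// exprn_ge0// mulr_ge0.
set K : R := ((2 ^ k.+1 * k.+1`!)%:R)^-1.
have K0 : 0 < K by rewrite invr_gt0 ltr0n muln_gt0 expn_gt0 fact_gt0.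
(* The [l] comes from the multiple count in [mean_cycles_ge]; the [2] gives up half of [ln n] to
   absorb [ln j0]. *)
pose c := K / 2 / l%:R.
have lR : (0 : R) < l%:R by rewrite ltr0n.
have c0 : 0 < c by rewrite !divr_gt0.
pose j0 := k.+1.*2.
have j01 : (1 < j0)%N by rewrite /j0 -addnn; lia.
have ln_big : \forall n \near \oo, 1 <= ln (n%:R : R) /\ 2 * ln (j0%:R : R) <= ln n%:R.
  exists (maxn (j0 ^ 2) (Num.truncn (expR 1 : R)).+1) => // n /=.
  rewrite geq_max => /andP[n1 n2]; split.
    rewrite -[leLHS]expRK ler_ln ?posrE ?expR_gt0// ?ltr0n ?(leq_trans _ n2)//.
    apply/ltW/(lt_le_trans (truncnS_gt _)).
    by rewrite ler_nat.
  rewrite mulr_natl -lnXn ?ltr0n ?(ltnW j01)// -natrX ler_ln ?posrE ?ltr0n ?ler_nat//.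
  by apply: leq_trans n1; rewrite expn_gt0 (ltnW j01).
have lower n : 1 <= ln (n%:R : R) /\ 2 * ln (j0%:R : R) <= ln n%:R ->
    c * ln n%:R <= mean_cycles R m l n.
  move=> [_ h]; have := mean_cycles_ge R k n hm.
  rewrite -/l -/K -/j0 => h2.
  rewrite /c -(ler_pM2l lR); apply: le_trans h2.
  have -> : l%:R * (K / 2 / l%:R * ln n%:R) = K * (ln n%:R / 2) :> R.
    by move: lR; move: (l%:R) => x x0; field; rewrite gt_eqF.
  rewrite ler_pM2l//; lra.
split.
  (* Once [ln n >= 1], [1 + ln n] is at most [2 * ln n]; the summand [c] ensures that the constants
     are ordered. *)
  exists c, (c + 2 * D1); split=> //; split; first by rewrite lerDl mulr_ge0.
  apply: filterS ln_big => n h; rewrite lower//=.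
  apply: (le_trans (mean_cycles_le R m k n)).
  rewrite -/D1; case: h => h _.
  have : 0 <= D1 * (ln n%:R - 1) by rewrite mulr_ge0// subr_ge0.
  have : 0 <= c * ln n%:R by rewrite mulr_ge0 ?(ltW c0)// (le_trans _ h).
  lra.
have [C C0 hC] := local_error_bounded R m k.
(* The inverse mean is at most [1 / (c * ln n)], and [1 + C] is positive even if [C] is [0]. *)
exists ((1 + C) / c); split; first by rewrite divr_gt0// ltr_wpDr.
apply: filterS ln_big => n h.
have lnn : 0 < ln (n%:R : R) by case: h => /(lt_le_trans ltr01).
have mu0 : 0 < mean_cycles R m l n.
  by apply: lt_le_trans (lower _ h); rewrite mulr_gt0.
apply: (le_trans (dTV_le mu0 (hC n) _)) => //.
rewrite lee_fin mulrC -mulrA -invfM ler_pM//.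
- by rewrite invr_ge0 ltW.
- by rewrite lerDr.
- by rewrite lef_pV2 ?posrE//; [exact: lower|exact: mulr_gt0].
Qed.
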